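(* For every $\lambda>\mu_t^4-1$, where $\mu_t$ is the taxi walk connective constant, the hard-core model on $\mathbb{Z}^2$ with activity $\lambda$ admits multiple Gibbs states.
   Context: The Manhattan lattice $\vec{\mathbb{Z}}^2$ is the orientation of $\mathbb{Z}^2$ in which an edge parallel to the $x$-axis is oriented in the positive $x$-direction iff its $y$-coordinate is even, and an edge parallel to the $y$-axis is oriented in the positive $y$-direction iff its $x$-coordinate is even. A taxi walk of length $n$ is an oriented $n$-step walk in $\vec{\mathbb{Z}}^2$ from the origin that never revisits a vertex and never takes two left or two right turns in a row. Let $c_n$ be the number of taxi walks of length $n$; the taxi walk connective constant is $\mu_t=\lim_{n\to\infty}c_n^{1/n}$ (this limit exists and equals $\inf_n c_n^{1/n}$). A Gibbs state for the hard-core model on $\mathbb{Z}^2$ with activity $\lambda$ is a probability measure on independent sets of $\mathbb{Z}^2$ such that for every finite $\Lambda\subset\mathbb{Z}^2$, conditionally on the configuration outside $\Lambda$, the configuration inside $\Lambda$ is distributed proportionally to $\lambda^{|I\cap\Lambda|}$ over compatible independent sets $I$. *)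

(* Defs.v *)
From HB Require Import structures.
From mathcomp Require Import all_boot all_order all_algebra finmap.
From mathcomp Require Import all_classical all_reals all_analysis.

Set Implicit Arguments.
Unset Strict Implicit.
Unset Printing Implicit Defensive.

Import Order.TTheory GRing.Theory Num.Theory numFieldNormedType.Exports.

Local Open Scope classical_set_scope.
Local Open Scope ring_scope.

Notation Z2 := (int * int)%type.

Definition manhattan (u v : Z2) : bool :=
  (v == (u.1 + (-1) ^+ odd `|u.2|%N, u.2)) ||
  (v == (u.1, u.2 + (-1) ^+ odd `|u.1|%N)).

(* The heading [d : 'Z_4] stands for the unit vector ['i ^+ d], so that
   [d + 1] is a left turn and [d - 1] a right turn. *)
Definition step (d : 'Z_4) : Z2 :=
  match val d with
  | 0 => (1, 0)
  | 1 => (0, 1)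
  | 2 => (-1, 0)
  | _ => (0, -1)
  end.

(* A walk from the origin is given by its successive headings; [positions s]
   is the list of the vertices it visits after the origin. *)
Definition positions (s : seq 'Z_4) : seq Z2 := scanl +%R 0 (map step s).

(* [(turns s)_i = s_(i+1) - s_i]: 1 is a left turn, -1 a right turn and 0 no
   turn.  [behead] drops the junk value [s_0 - 0]. *)
Definition turns (s : seq 'Z_4) : seq 'Z_4 :=
  behead (pairmap (fun d e => e - d) 0 s).

Definition taxi_walk (s : seq 'Z_4) : bool :=
  [&& path manhattan 0 (positions s),
      uniq (0 :: positions s),
      ~~ infix [:: 1; 1] (turns s)
    & ~~ infix [:: -1; -1] (turns s)].

Definition taxi_count (n : nat) : nat := #|[pred s : n.-tuple 'Z_4 | taxi_walk s]|.

Definition taxi_connective_constant (R : realType) : R :=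
  limn (fun n : nat => (taxi_count n)%:R `^ n%:R^-1 : R).

Definition lattice_adj (u v : Z2) : bool :=
  (`|u.1 - v.1| + `|u.2 - v.2| == 1)%N.

Definition independent : set (set Z2) :=
  [set I | forall u v, I u -> I v -> ~~ lattice_adj u v].

Definition config : Type := set_type independent.

HB.instance Definition _ := Choice.on config.

Fact independent0 : set0 \in independent.
Proof. by rewrite inE. Qed.

HB.instance Definition _ := isPointed.Build config (exist _ set0 independent0).

Definition occupied (v : Z2) : set config := [set I | val I v].

(* Generators of the sigma-algebra of the events depending only on the
   configuration in [D]. *)
Definition occupied_in (D : set Z2) : set (set config) := occupied @` D.

(* The product sigma-algebra of {0,1}^Z2, restricted to independent sets. *)
Notation hc_space := (g_sigma_algebraType (occupied_in setT)).

Section HardCore.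
Context {R : realType}.

(* [f] is a version of the conditional probability of the event [A] given the
   sub-sigma-algebra [F]. *)
Definition is_conditional_probability d (T : measurableType d)
    (P : probability T R) (F : set (set T)) (A : set T) (f : T -> R) : Prop :=
  (forall Y : set R, measurable Y -> F (f @^-1` Y)) /\
  (forall B, F B -> P (A `&` B) = \int[P]_(x in B) (f x)%:E)%E.

Variable lambda : R.

Definition compatible (L J : {fset Z2}) (I : config) : Prop :=
  independent ([set` J] `|` (val I `\` [set` L])).

(* The weight of [J] (a subset of [L]) as configuration inside [L], given that
   the configuration outside [L] is that of [I]. *)
Definition hc_weight (L : {fset Z2}) (I : config) (J : {fset Z2}) : R :=
  if `[< compatible L J I >] then lambda ^+ #|` J| else 0.

Definition hc_spec (L : {fset Z2}) (J : {fset Z2}) (I : config) : R :=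
  hc_weight L I J / \sum_(K <- fpowerset L) hc_weight L I K.

Definition inside_is (L J : {fset Z2}) : set config :=
  [set I | val I `&` [set` L] = [set` J]].

Definition gibbs_state (P : probability hc_space R) : Prop :=
  forall L J : {fset Z2}, (J `<=` L)%fset ->
    is_conditional_probability P <<s occupied_in (~` [set` L]) >>
      (inside_is L J) (hc_spec L J).

End HardCore.

(* Measures are functions on all sets, with unspecified values on the
   non-measurable ones: distinct measures must differ on a measurable set. *)
Definition multiple_gibbs_states (R : realType) (lambda : R) : Prop :=
  exists P Q : probability hc_space R,
    [/\ gibbs_state lambda P, gibbs_state lambda Q
      & exists2 A : set hc_space, measurable A & P A <> Q A].

(* Main.v *)
(* A Peierls argument. In a large box fix a boundary condition occupying all
   sites of parity q. A large cluster of the other phase, or a large hole in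
   the outer cluster of the phase q, is separated from its surroundings by a
   closed contour of dual edges both of whose sites are empty, the inner sites
   having parity q. At each face such a contour turns left or right, and in
   the medial lattice, which is a Manhattan lattice, it traces a self-avoiding
   walk. Three left turns in a row would isolate a site of the cluster and
   three right turns would close the contour after four steps, so this is a
   taxi walk, and up to a subexponential factor there are at most mu_t^p
   contours of length p around a given site.
   The region enclosed by a contour of length p can be shifted by one step in
   each of the four directions. Shifting against the most frequent direction
   frees at least p / 4 sites of parity q which can be filled arbitrarily, so
   the contour has probability at most (1 + lambda)^(- p / 4). Since
   mu_t^4 < 1 + lambda, large contours are unlikely. Hence the limits of the
   finite-volume measures with the two boundary conditions give different
   probabilities to the existence of a large cluster of a given phase. *)
From HB Require Import structures.
Require Import Defs.
From mathcomp Require Import all_boot all_order all_algebra finmap zify ring lra.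
From mathcomp Require Import all_classical all_reals all_analysis.
From mathcomp Require Import measurable_realfun.

Set Implicit Arguments.
Unset Strict Implicit.
Unset Printing Implicit Defensive.

Import Order.TTheory GRing.Theory Num.Theory numFieldNormedType.Exports.
Local Open Scope ring_scope.

(** * Contours and winding numbers *)

(** The interior of a contour is produced algebraically. Because all inner sites have one parity,
    every boundary edge of a finite cluster must turn at the next face, and the rule [nxt] permutes
    the boundary edges. The contour is the orbit of the edge to the right of a rightmost site, and
    its interior is the set of sites of positive winding number, whose boundary is exactly that
    orbit. On the probabilistic side, the specification in [L] depends on the outside only through
    the finite set of admissible inner configurations. This set takes finitely many values, so the
    Gibbs property is a finite linear identity between events and passes to limits along an
    ultrafilter. Such a limit is only finitely additive; a genuine probability is obtained from it
    by reading a uniform point of [0, 1[ as a sequence of occupation bits, and the identity is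
    carried from cylinders to the whole outer sigma-algebra by a pi-lambda argument. *)

Lemma Z4_ind (P : 'Z_4 -> Prop) : P 0 -> P 1 -> P (1 + 1) -> P (- 1) ->
  forall d, P d.
Proof.
move=> P0 P1 P2 P3 [[|[|[|[|//]]]] i].
- by rewrite (_ : Ordinal i = 0) //; apply/val_inj.
- by rewrite (_ : Ordinal i = 1) //; apply/val_inj.
- by rewrite (_ : Ordinal i = 1 + 1) //; apply/val_inj.
- by rewrite (_ : Ordinal i = - 1) //; apply/val_inj.
Qed.

Lemma stepP (d : 'Z_4) :
  ((step d).1 = 1 /\ (step d).2 = 0 \/ (step d).1 = -1 /\ (step d).2 = 0) \/
  ((step d).1 = 0 /\ (step d).2 = 1 \/ (step d).1 = 0 /\ (step d).2 = -1).
Proof. by elim/Z4_ind: d; [left; left|right; left|left; right|right; right]. Qed.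

Lemma Z4_neq : ((0 == 1 :> 'Z_4) = false) * ((0 == 1 + 1 :> 'Z_4) = false)
  * ((0 == -1 :> 'Z_4) = false) * ((1 == 0 :> 'Z_4) = false)
  * ((1 == 1 + 1 :> 'Z_4) = false) * ((1 == -1 :> 'Z_4) = false)
  * ((1 + 1 == 0 :> 'Z_4) = false) * ((1 + 1 == 1 :> 'Z_4) = false)
  * ((1 + 1 == -1 :> 'Z_4) = false) * ((-1 == 0 :> 'Z_4) = false)
  * ((-1 == 1 :> 'Z_4) = false) * ((-1 == 1 + 1 :> 'Z_4) = false).
Proof. by []. Qed.

Lemma stepS d : step (d + 1) = (- (step d).2, (step d).1).
Proof. by elim/Z4_ind: d. Qed.

Lemma stepB d : step (d - 1) = ((step d).2, - (step d).1).
Proof. by elim/Z4_ind: d. Qed.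

Lemma stepSS d : step (d + 1 + 1) = - step d.
Proof. by elim/Z4_ind: d. Qed.

Lemma step_inj : injective step.
Proof. by elim/Z4_ind; elim/Z4_ind. Qed.

Lemma Z2D1 (u v : Z2) : (u + v).1 = u.1 + v.1. Proof. by []. Qed.
Lemma Z2D2 (u v : Z2) : (u + v).2 = u.2 + v.2. Proof. by []. Qed.
Lemma Z2N1 (u : Z2) : (- u).1 = - u.1. Proof. by []. Qed.
Lemma Z2N2 (u : Z2) : (- u).2 = - u.2. Proof. by []. Qed.
Definition Z2E := (Z2D1, Z2D2, Z2N1, Z2N2).

Lemma eq_Z2 (u v : Z2) : (u == v) = (u.1 == v.1) && (u.2 == v.2).
Proof. by case: u v => ? ? [? ?]. Qed.

Lemma lattice_adjP u v :
  reflect (exists d, v = u + step d) (lattice_adj u v).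
Proof.
apply: (iffP idP) => [|[d ->]]; last first.
  rewrite /lattice_adj !Z2E; have := stepP d; lia.
case: u v => a b [a' b']; rewrite /lattice_adj /= => /eqP uv.
have: (a' = a + 1 /\ b' = b \/ a' = a - 1 /\ b' = b) \/
  (a' = a /\ b' = b + 1 \/ a' = a /\ b' = b - 1) by lia.
case=> [] [] [v1 v2]; [exists 0|exists (1 + 1)|exists 1|exists (-1)];
  by apply/eqP; rewrite eq_Z2 v1 v2 !Z2E /= ?addr0 !eqxx.
Qed.

Lemma lattice_adjC u v : lattice_adj u v = lattice_adj v u.
Proof. by rewrite /lattice_adj; lia. Qed.

Notation state := (Z2 * 'Z_4)%type.

(* The state (x, h) is the dual edge separating x, on its left, from
   x + step h, on its right. The centers of the faces at both ends are
   doubled in order to be integral. *)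
Definition right_site (e : state) : Z2 := e.1 + step e.2.
Definition head_face (e : state) : Z2 := e.1 + right_site e + step (e.2 + 1).
Definition tail_face (e : state) : Z2 := e.1 + right_site e + step (e.2 - 1).
Definition turn_left (e : state) : state := (e.1, e.2 + 1).
Definition turn_right (e : state) : state :=
  (right_site e + step (e.2 + 1), e.2 - 1).

Lemma tail_turn_left e : tail_face (turn_left e) = head_face e.
Proof.
rewrite /tail_face /head_face /turn_left /right_site /= addrK -!addrA.
by congr (_ + (_ + _)); rewrite addrC.
Qed.

Lemma tail_turn_right e : tail_face (turn_right e) = head_face e.
Proof.
apply/eqP; rewrite /tail_face /head_face /turn_right /right_site /=.
rewrite eq_Z2 !Z2E !stepB !stepS /=.
by move: e => [[x y] d] /=; case: (step d) => a b /=; lia.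
Qed.

Definition crossing (u : Z2) (e : state) : int :=
  if (e.1.2 == u.2) && (u.1 + u.1 < e.1.1 + (right_site e).1)
  then (step e.2).1 else 0.

(* The winding number of the contour [g] around [u], as the number of signed
   crossings of the ray from [u] to the right. *)
Definition winding (g : seq state) (u : Z2) : int := \sum_(e <- g) crossing u e.

Definition in_strip (u f : Z2) : bool :=
  (u.1 + u.1 < f.1) && (u.2 + u.2 < f.2 < u.2 + u.2 + 2).

(** A dual edge enters or leaves the half-infinite strip through its lower side ([crossing u]), its
    upper side ([crossing (u + step 1)]) or its left end, the dual edge between [u] and
    [u + step 1]. Over a closed contour the left-hand sides cancel. *)
Lemma in_strip_faces u e :
  (in_strip u (head_face e) : nat)%:Z - (in_strip u (tail_face e) : nat)%:Z =
  crossing u e - crossing (u + step 1) e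
  - ((e == (u, 1)) : nat)%:Z + ((e == (u + step 1, -1)) : nat)%:Z.
Proof.
case: u e => a b [[x y]]; elim/Z4_ind; rewrite /in_strip /crossing /head_face
  /tail_face /right_site ?xpair_eqE /= ?eq_Z2 ?Z2E ?Z4_neq ?eqxx /=;
  do 2?case: ifP => ?; lia.
Qed.

Definition closed_contour (g : seq state) : Prop :=
  perm_eq (map head_face g) (map tail_face g).

Lemma sum_mem (T : eqType) (s : seq T) (x : T) : uniq s ->
  \sum_(e <- s) ((e == x : nat)%:Z) = ((x \in s : nat)%:Z).
Proof.
elim: s => [|y s IH] /=; first by rewrite big_nil.
case/andP=> yNs us; rewrite big_cons IH // inE eq_sym.
case: eqVneq => [->|] //=; by rewrite (negPf yNs).
Qed.

Lemma winding_step1 g u : uniq g -> closed_contour g ->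
  winding g u - winding g (u + step 1) =
  ((u, 1) \in g : nat)%:Z - ((u + step 1, -1) \in g : nat)%:Z.
Proof.
move=> ug cg; rewrite -!sum_mem // /winding -!sumrB.
apply/eqP; rewrite -subr_eq0 -sumrB; apply/eqP.
transitivity (\sum_(e <- g) ((in_strip u (head_face e) : nat)%:Z
   - (in_strip u (tail_face e) : nat)%:Z)).
  by apply: eq_bigr => e _; rewrite in_strip_faces; ring.
rewrite sumrB.
rewrite -(big_map head_face xpredT (fun f => (in_strip u f : nat)%:Z)).
rewrite -(big_map tail_face xpredT (fun f => (in_strip u f : nat)%:Z)).
by rewrite (perm_big _ cg) subrr.
Qed.

(** The rays from two neighbors in a row differ by a single dual edge, so the identity holds term by
    term. *)
Lemma winding_step0 g u : uniq g ->
  winding g u - winding g (u + step 0) =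
  ((u, 0) \in g : nat)%:Z - ((u + step 0, 1 + 1) \in g : nat)%:Z.
Proof.
move=> ug; rewrite -!sum_mem // /winding -!sumrB.
case: u => a b; apply: eq_bigr => -[[x y]]; elim/Z4_ind.
all: by rewrite /crossing /right_site ?xpair_eqE /= ?eq_Z2 ?Z2E ?Z4_neq ?eqxx /=;
  do 2?case: ifP => ?; lia.
Qed.

Lemma winding_step g u d : uniq g -> closed_contour g ->
  winding g u - winding g (u + step d) =
  ((u, d) \in g : nat)%:Z - ((u + step d, d + 1 + 1) \in g : nat)%:Z.
Proof.
move=> ug cg; elim/Z4_ind: d.
- by rewrite winding_step0 // add0r.
- by rewrite winding_step1 // (_ : 1 + 1 + 1 = -1) //; apply/val_inj.
- set v := u + _; have -> : u = v + step 0.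
    by rewrite /v; apply/eqP; rewrite eq_Z2 !Z2E /= !(addr0, subrK) !eqxx.
  have -> : (1 + 1 + 1 + 1 : 'Z_4) = 0 by apply/val_inj.
  by rewrite -opprB winding_step0 // opprB.
- set v := u + _; have -> : u = v + step 1.
    by rewrite /v; apply/eqP; rewrite eq_Z2 !Z2E /= !(addr0, subrK) !eqxx.
  have -> : (-1 + 1 + 1 : 'Z_4) = 1 by apply/val_inj.
  by rewrite -opprB winding_step1 // opprB.
Qed.

Definition parity (u : Z2) : bool := odd `|(u.1 + u.2)%R|%N.

Lemma parity_step u d : parity (u + step d) = ~~ parity u.
Proof.
rewrite /parity !Z2E; have := stepP d.
by case: u (step d) => a b [c e] /=; lia.
Qed.

Lemma turn_left_inj : injective turn_left.
Proof.
by move=> [x h] [y k] /eqP; rewrite xpair_eqE /= => /andP[/eqP-> /eqP/addIr->].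
Qed.

Lemma turn_right_inj : injective turn_right.
Proof.
move=> [x h] [y k] /eqP; rewrite xpair_eqE /= => /andP[+ /eqP/addIr hk].
rewrite hk /right_site /=; by rewrite !(inj_eq (addIr _)) => /eqP ->.
Qed.

Lemma right_turn_right e : right_site (turn_right e) = right_site e.
Proof.
apply/eqP; rewrite /turn_right /right_site /= eq_Z2 !Z2E stepB stepS /=.
by move: e => [[x y] d] /=; case: (step d) => a b /=; lia.
Qed.

Lemma turn_right4 e : turn_right (turn_right (turn_right (turn_right e))) = e.
Proof.
case: e => -[x y] h; rewrite /turn_right /right_site /=; congr (_, _).
  by apply/eqP; elim/Z4_ind: h; rewrite eq_Z2 /=; lia.
by elim/Z4_ind: h; apply/val_inj.
Qed.

(** Here [e] and [e'] enter the same face from opposite sides, so the site to which [e'] would turn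
    right is [e.1]. This rules out a common successor of two boundary edges. *)
Lemma turn_right_left e e' :
  turn_right e = turn_left e' -> (turn_right e').1 = e.1.
Proof.
case: e e' => -[x1 x2] h [y k] /eqP; rewrite xpair_eqE /= => /andP[/eqP xy /eqP hk].
have {hk}-> : k = h - 1 - 1 by rewrite hk addrK.
rewrite /turn_right /right_site /= -xy /right_site /=; apply/eqP.
by elim/Z4_ind: h {xy}; rewrite eq_Z2 ?Z2E /=; lia.
Qed.

Lemma map_traject (T : Type) (f : T -> T) x n :
  map f (traject f x n) = traject f (f x) n.
Proof. by elim: n x => //= n IH x; rewrite IH. Qed.

(* One step of the dual walk whose taxi walk has heading [t]. *)
Definition turn (e : state) (t : 'Z_4) : state :=
  if t == e.2 + 1 then turn_left e else turn_right e.

Definition contour (x : Z2) (s : seq 'Z_4) : seq state :=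
  (x, 0) :: scanl turn (x, 0) s.

(** * Boundary walks of a finite set *)

Section Boundary.
Variable A : {fset Z2}.

Definition bd (e : state) : bool := (e.1 \in A) && (right_site e \notin A).

(** At a face where two sites of [A] touch only at a corner, either turn would follow the boundary;
    preferring the right turn treats these sites as joined. *)
Definition nxt (e : state) : state :=
  if (turn_right e).1 \in A then turn_right e else turn_left e.

Definition heading (e : state) : 'Z_4 :=
  if (turn_right e).1 \in A then e.2 else e.2 + 1.

Lemma nxt_inj : {in bd &, injective nxt}.
Proof.
move=> e e' /andP[eA _] /andP[e'A _]; rewrite /nxt.
case: ifP => rA; case: ifP => r'A.
- exact: turn_right_inj.
- by move/turn_right_left => E; rewrite E eA in r'A.
- by move/esym/turn_right_left => E; rewrite E e'A in rA.
- exact: turn_left_inj.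
Qed.

Lemma head_face_nxt e : tail_face (nxt e) = head_face e.
Proof. by rewrite /nxt; case: ifP; rewrite ?tail_turn_right ?tail_turn_left. Qed.

Variable q : bool.
Hypothesis bd_parity : forall e, bd e -> parity e.1 = q.

(** If the diagonal site is outside [A], so is the site ahead on the left: otherwise the edge
    between these two would be a boundary edge with an inner site of the wrong parity. Hence the
    boundary never goes straight. *)
Lemma bd_nxt e : bd e -> bd (nxt e).
Proof.
move=> be; have /andP[xA yA] := be; rewrite /nxt; case: ifP => rA.
  by rewrite /bd rA right_turn_right.
rewrite /bd /= xA /=; apply/negP => x'A.
have b' : bd (e.1 + step (e.2 + 1), e.2).
  move: rA x'A; rewrite /bd /right_site /turn_right /= => rA ->.
  by rewrite -addrA (addrC (step _)) addrA rA.
by have := bd_parity b'; rewrite /= parity_step (bd_parity be); case: (q).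
Qed.

Lemma bd_iter n e : bd e -> bd (iter n nxt e).
Proof. by move=> be; elim: n => //= n; apply: bd_nxt. Qed.

Lemma bd_finite : exists B : {fset state}, forall e, (e \in B) = bd e.
Proof.
exists [fset e in [seq (x, d) | x <- enum_fset A, d <- enum 'Z_4] | bd e]%fset.
move=> e; rewrite !inE /=; case be: (bd e); rewrite ?andbF // andbT.
apply/allpairsP; exists e; rewrite mem_enum; split=> //; last by case: e {be}.
by case/andP: be.
Qed.

Lemma orbit_exists e0 : bd e0 -> exists p, [/\ (0 < p)%N,
  uniq (traject nxt e0 p) & iter p nxt e0 = e0].
Proof.
move=> be0; have [B BE] := bd_finite.
have fP (e : B) : nxt (val e) \in B.
  by rewrite BE; apply: bd_nxt; rewrite -BE; exact: valP.
pose f (e : B) : B := [` fP e]%fset.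
have f_inj : injective f.
  move=> e e' /(congr1 val) /= /nxt_inj E; apply: val_inj.
  by apply: E; rewrite -[_ \in _]BE; exact: valP.
have e0B : e0 \in B by rewrite BE.
pose e : B := [` e0B]%fset.
have iterE n : val (iter n f e) = iter n nxt e0 by elim: n => //= n ->.
have trajE n : map val (traject f e n) = traject nxt e0 n.
  by apply: (@eq_from_nth _ e0); rewrite ?size_map ?size_traject // => i ilt;
    rewrite (nth_map e) ?size_traject // !nth_traject.
exists (order f e); split; first exact: order_gt0.
- by rewrite -trajE map_inj_uniq ?orbit_uniq //; exact: val_inj.
- by rewrite -iterE iter_order.
Qed.

Lemma closed_traject e0 p : iter p nxt e0 = e0 ->
  closed_contour (traject nxt e0 p).
Proof.
move=> pe; rewrite /closed_contour.
have -> : map head_face (traject nxt e0 p) =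
    map tail_face (map nxt (traject nxt e0 p)).
  by rewrite -map_comp; apply: eq_map => e /=; rewrite head_face_nxt.
apply: perm_map; case: p pe => // p pe; rewrite map_traject trajectSr -iterSr pe.
by rewrite trajectS perm_rcons.
Qed.

Lemma turn_heading e : turn e (heading e) = nxt e.
Proof.
rewrite /turn /heading /nxt; case: ((turn_right e).1 \in A); rewrite ?eqxx //.
rewrite (_ : (e.2 == e.2 + 1) = false) //.
by elim/Z4_ind: (e.2).
Qed.

Lemma scanl_turn e n :
  scanl turn e (map heading (traject nxt e n)) = traject nxt (nxt e) n.
Proof. by elim: n e => //= n IH e; rewrite turn_heading IH. Qed.
End Boundary.

(** * The interior of a boundary orbit *)

Definition in_box (n : nat) (u : Z2) : bool :=
  (`|u.1|%N <= n)%N && (`|u.2|%N <= n)%N.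

Lemma crossing_out n v (e : state) :
  in_box n e.1 -> ~~ in_box n v -> - n%:Z <= v.1 -> crossing v e = 0.
Proof.
case: e => -[a b] h; rewrite /crossing /in_box /right_site /=.
by case: v => c d; elim/Z4_ind: h; rewrite ?Z2E /=; case: ifP => //; lia.
Qed.

Lemma step_muln d k :
  step d *+ k = ((step d).1 * k%:Z, (step d).2 * k%:Z).
Proof.
elim: k => [|k IH]; first by rewrite mulr0n !mulr0.
by rewrite mulrSr IH; apply/eqP; rewrite eq_Z2 /= !intS; lia.
Qed.

Lemma crossing_row v (e : state) : e.1.2 != v.2 -> crossing v e = 0.
Proof. by rewrite /crossing => /negPf->. Qed.

Inductive linked (S : Z2 -> Prop) (u : Z2) : Z2 -> Prop :=
| linked_refl : S u -> linked S u u
| linked_next x y : linked S u x -> S y -> lattice_adj x y -> linked S u y.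

Lemma linked_right S u v : linked S u v -> S v. Proof. by case. Qed.

Lemma linked_left S u v : linked S u v -> S u. Proof. by elim. Qed.

Lemma linked_last S u v : linked S u v ->
  u = v \/ exists2 w, S w & lattice_adj v w.
Proof.
case=> [_|x y ux _ xy]; [by left|right; exists x; last by rewrite lattice_adjC].
exact: linked_right ux.
Qed.

Lemma linked_trans S u v w : linked S u v -> linked S v w -> linked S u w.
Proof. by move=> uv; elim=> // x y _; exact: linked_next. Qed.

Lemma linked_sym S u v : linked S u v -> linked S v u.
Proof.
elim=> [|x y ux xu Sy xy]; first exact: linked_refl.
apply: linked_trans xu; apply: (@linked_next _ _ y); last by rewrite lattice_adjC.
  exact: linked_refl.
exact: linked_right ux.
Qed.

Section Orbit.
Variables (A : {fset Z2}) (q : bool).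
Hypothesis bd_parity : forall e, bd A e -> parity e.1 = q.
Variables (x0 : Z2) (p : nat).
Hypothesis x0A : x0 \in A.
Hypothesis x0max : forall x : Z2, x \in A -> x.1 <= x0.1.
Let e0 : state := (x0, 0).
Let g := traject (nxt A) e0 p.
Hypothesis p_gt0 : (0 < p)%N.
Hypothesis g_uniq : uniq g.
Hypothesis g_closed : iter p (nxt A) e0 = e0.

Lemma bd_e0 : bd A e0.
Proof.
clear p_gt0 g_uniq g_closed; rewrite /bd /= x0A /=; apply/negP => /x0max; rewrite /right_site /= ?Z2E /=.
by case: x0 => a b /=; lia.
Qed.

Lemma orbit_bd e : e \in g -> bd A e.
Proof. by case/trajectP => i _ ->; exact: (bd_iter bd_parity _ bd_e0). Qed.

Lemma mem_e0 : e0 \in g.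
Proof. by rewrite /g; case: p p_gt0 => //= k _; rewrite inE eqxx. Qed.

(** As [x0] is rightmost in [A], the only contour edge crossing its ray is [e0]. *)
Lemma winding_x0 : winding g x0 = 1.
Proof.
transitivity (((e0 \in g) : nat)%:Z); last by rewrite mem_e0.
rewrite -sum_mem // /winding !big_seq; apply: eq_bigr => e /orbit_bd /andP[eA _].
move: eA => /x0max; rewrite /e0; case: e => -[a b] h; case: (x0) => a0 b0.
rewrite xpair_eqE eq_Z2 /=.
elim/Z4_ind: h; rewrite /crossing /right_site ?Z2E ?Z4_neq ?eqxx /= => ?;
  try case: ifP => ?; lia.
Qed.

Lemma winding_bd u d : bd A (u, d) ->
  winding g u - winding g (u + step d) = ((u, d) \in g : nat)%:Z.
Proof.
case/andP => _ yA; rewrite (winding_step _ _ g_uniq (closed_traject g_closed)).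
rewrite (_ : (u + step d, d + 1 + 1) \in g = false) ?subr0 //.
by apply/negP => /orbit_bd /andP[/= yA' _]; rewrite /right_site /= yA' in yA.
Qed.

(** Across an orbit edge the winding number drops by one, since the reversed edge is not a boundary
    edge. Consecutive edges share a site, the left one after a left turn and the right one after a
    right turn, so the values at [e0] propagate along the orbit. *)
Lemma winding_orbit e : e \in g ->
  winding g e.1 = 1 /\ winding g (right_site e) = 0.
Proof.
have drop e' : e' \in g -> winding g (right_site e') = winding g e'.1 - 1.
  case: e' => u d eg; have := winding_bd (orbit_bd eg); rewrite eg /right_site /=.
  move/eqP; rewrite subr_eq => /eqP ->; ring.
move=> eg; rewrite drop //; suff -> : winding g e.1 = 1 by split.
case/trajectP: eg => i ip ->; elim: i ip => [|i IH] ip.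
  by rewrite /= winding_x0.
have ig : iter i (nxt A) e0 \in g by apply/trajectP; exists i => //; exact: ltnW.
have sg : iter i.+1 (nxt A) e0 \in g by apply/trajectP; exists i.+1.
move: (drop _ sg) (drop _ ig) (IH (ltnW ip)); rewrite /=.
have [->|-> //] : nxt A (iter i (nxt A) e0) = turn_right (iter i (nxt A) e0) \/
  nxt A (iter i (nxt A) e0) = turn_left (iter i (nxt A) e0).
  by rewrite /nxt; case: ifP; [left|right].
rewrite right_turn_right => E Er Ei.
by apply/eqP; move/eqP: E; rewrite Er Ei; lia.
Qed.

(** Across an edge outside the orbit the winding number cannot decrease in direction [d]. So the
    sites of positive winding number have boundary exactly [g] and serve as its interior. *)
Lemma winding_gt0_step u d :
  (0 < winding g u) && ~~ (0 < winding g (u + step d)) = ((u, d) \in g).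
Proof.
have [ug|uNg] := boolP ((u, d) \in g).
  by have [-> ] := winding_orbit ug; rewrite /right_site /= => ->.
have := winding_step u d g_uniq (closed_traject g_closed).
rewrite -/g (negPf uNg) /=; case: ((_, _) \in g) => /=; lia.
Qed.

Lemma winding_in u d : u \in A -> u + step d \in A ->
  winding g (u + step d) = winding g u.
Proof.
move=> uA vA; apply/eqP; rewrite eq_sym -subr_eq0.
rewrite (winding_step _ _ g_uniq (closed_traject g_closed)).
rewrite -/g (_ : _ \in g = false); last first.
  by apply/negP => /orbit_bd /andP[_]; rewrite /right_site /= vA.
rewrite (_ : _ \in g = false) //.
apply/negP => /orbit_bd /andP[_]; rewrite /right_site /= stepSS.
by rewrite addrK uA.
Qed.

Lemma winding_out u d : u \notin A -> u + step d \notin A ->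
  winding g (u + step d) = winding g u.
Proof.
move=> uA vA; apply/eqP; rewrite eq_sym -subr_eq0.
rewrite (winding_step _ _ g_uniq (closed_traject g_closed)).
rewrite -/g (_ : _ \in g = false); last first.
  by apply/negP => /orbit_bd /andP[]; rewrite /= (negPf uA).
rewrite (_ : _ \in g = false) //.
by apply/negP => /orbit_bd /andP[]; rewrite /= (negPf vA).
Qed.

Lemma winding_linked u : linked (fun x => x \in A) x0 u -> winding g u = 1.
Proof.
elim=> [_|x y xl Ix yA /lattice_adjP[d yE]]; first exact: winding_x0.
by rewrite yE winding_in // -?yE //; exact: linked_right xl.
Qed.

Variable n : nat.
Hypothesis Abox : forall x : Z2, x \in A -> in_box n x.

(** Outside the box the ray from [u] misses the contour unless [u] is to the left of the box. In
    that case [u] is first moved up, through sites outside [A] where the winding number is constant,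
    to a row above the box. *)
Lemma winding_box u : 0 < winding g u -> in_box n u.
Proof.
apply: contraTT => uNb.
have row v : ~~ in_box n v -> - n%:Z <= v.1 -> winding g v = 0.
  move=> vNb H; rewrite /winding big_seq big1 // => e /orbit_bd /andP[/Abox].
  by move=> eb _; exact: crossing_out eb vNb H.
suff W : winding g u = 0 by rewrite W.
have [l|l] := boolP (u.1 < - n%:Z); last first.
  by apply: row => //; move: l; case: (u) => a b /=; lia.
have col k : u + step 1 *+ k = (u.1, u.2 + k%:Z).
  by rewrite step_muln mul0r mul1r; case: (u) => a b; congr (_, _); exact: addr0.
have up k : winding g (u + step 1 *+ k) = winding g u.
  elim: k => [|k IH]; first by rewrite mulr0n addr0.
  rewrite mulrSr addrA winding_out ?IH // -?addrA -?mulrSr col;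
    by apply/negP => /Abox; rewrite /in_box /=; lia.
rewrite -(up (n + `|u.2|).+1) col; rewrite /winding big_seq big1 // => e.
move=> /orbit_bd /andP[/Abox/andP[_ eb] _]; apply: crossing_row.
by apply: contraTneq eb => ->; case: (u) => a b /=; lia.
Qed.

Lemma winding_exit u d : 0 < winding g u ->
  exists k : nat, (u + step d *+ k, d) \in g.
Proof.
move=> wu.
have [k wk] : exists k, ~~ (0 < winding g (u + step d *+ k)).
  exists (`|u.1| + `|u.2| + n).+1; apply: contraL wu => /winding_box.
  rewrite /in_box step_muln /= => H; exfalso; move: H.
  case: (u) => a b; case: (stepP d) => [] [] [-> ->] /=; lia.
have {wk}exk : exists k, ~~ (0 < winding g (u + step d *+ k)) by exists k.
case: (ex_minnP exk) => -[|m] wm minm; first by rewrite mulr0n addr0 wu in wm.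
exists m; rewrite -winding_gt0_step -addrA -mulrSr wm andbT.
by apply: contraT => /minm; rewrite ltnn.
Qed.

Lemma nxt_near e :
  (`|((nxt A e).1.1 - e.1.1)%R| <= 1)%N && (`|((nxt A e).1.2 - e.1.2)%R| <= 1)%N.
Proof.
case: e => -[a b] h; rewrite /nxt /turn_left /turn_right /right_site.
by case: ifP => _; elim/Z4_ind: h; rewrite /=; lia.
Qed.

Lemma orbit_near e : e \in g ->
  (`|(e.1.1 - x0.1)%R| <= p)%N && (`|(e.1.2 - x0.2)%R| <= p)%N.
Proof.
case/trajectP=> i /ltnW ip ->.
suff : (`|((iter i (nxt A) e0).1.1 - x0.1)%R| <= i)%N &&
       (`|((iter i (nxt A) e0).1.2 - x0.2)%R| <= i)%N.
  by case/andP => l1 l2; rewrite (leq_trans l1) ?(leq_trans l2).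
elim: i {ip} => [|i]; first by rewrite /= !subrr.
have := nxt_near (iter i (nxt A) e0); rewrite -iterS.
move: (iter i.+1 _ _) (iter i _ _) => [[a b] h] [[c d] k] /=.
by case: (x0) => u v /=; lia.
Qed.

(** Leaving the interior to the right meets a contour edge in the row of [u], leaving it upwards
    meets one in its column; each bounds one coordinate. *)
Lemma winding_near u : 0 < winding g u -> in_box p (u - x0).
Proof.
move=> wu; have [k0 /orbit_near] := winding_exit 0 wu.
have [k1 /orbit_near] := winding_exit 1 wu.
rewrite !step_muln /in_box /=.
by case: (u) (x0) => a b [c d] /=; lia.
Qed.
End Orbit.

(** * Contours are taxi walks *)

Definition corner (h : 'Z_4) : Z2 :=
  if h == 0 then 0 else if h == 1 then (0, 1) else
  if h == 1 + 1 then (-1, 1) else (-1, 0).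

(* The edge midpoint [x + i^h / 2] in complex notation, in the coordinates
   [(1 - i) (z - x0) - (1 - i) / 2], where the walks turning left around even
   and right around odd sites are the walks of the Manhattan lattice. *)
Definition taxi_pos (x0 : Z2) (e : state) : Z2 :=
  (e.1.1 - x0.1 + (e.1.2 - x0.2), e.1.2 - x0.2 - (e.1.1 - x0.1)) + corner e.2.

Lemma taxi_pos_turn_left x0 e :
  taxi_pos x0 (turn_left e) = taxi_pos x0 e + step (e.2 + 1).
Proof.
case: e => x h; rewrite /taxi_pos /turn_left /= -[RHS]addrA.
by congr (_ + _); elim/Z4_ind: h.
Qed.

Lemma taxi_pos_turn_right x0 e :
  taxi_pos x0 (turn_right e) = taxi_pos x0 e + step e.2.
Proof.
apply/eqP; case: e x0 => -[x y] h [a b]; rewrite eq_Z2 /taxi_pos /turn_right.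
rewrite /right_site /=; elim/Z4_ind: h; rewrite /=; lia.
Qed.

Lemma taxi_pos_nxt A x0 e :
  taxi_pos x0 (nxt A e) = taxi_pos x0 e + step (heading A e).
Proof.
by rewrite /nxt /heading; case: ifP; rewrite ?taxi_pos_turn_left ?taxi_pos_turn_right.
Qed.

(** Since the inner sites all have the parity of [x0], both coordinates of [taxi_pos] are even
    before [corner] is added. *)
Lemma taxi_pos_manhattan x0 e d : parity e.1 = parity x0 ->
  d = e.2 \/ d = e.2 + 1 ->
  manhattan (taxi_pos x0 e) (taxi_pos x0 e + step d).
Proof.
rewrite /parity; case: e x0 => -[x y] h [x0 y0] /= ee.
pose a := x - x0 + (y - y0); pose b := y - y0 - (x - x0).
have oa : odd `|a| = false by rewrite /a; lia.
have ob : odd `|b| = false by rewrite /b; lia.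
have oa1 : odd `|(a - 1)%R| by rewrite /a; lia.
have ob1 : odd `|(b + 1)%R| by rewrite /b; lia.
rewrite /manhattan /taxi_pos /= -/a -/b => -[] ->;
  elim/Z4_ind: h; rewrite /= !xpair_eqE;
  rewrite ?addr0 ?add0r ?oa ?ob ?oa1 ?ob1 ?expr0 ?expr1 ?addrN1 ?eqxx ?orbT //=; lia.
Qed.

Lemma taxi_pos_inj x0 e e' : parity e.1 = parity x0 -> parity e'.1 = parity x0 ->
  taxi_pos x0 e = taxi_pos x0 e' -> e = e'.
Proof.
move=> pe pe' /eqP E; apply/eqP; move: pe pe' E; rewrite /parity /taxi_pos.
case: e e' x0 => -[x y] h [[x' y'] h'] [x0 y0] /= pe pe'.
rewrite eq_Z2 /= !xpair_eqE; elim/Z4_ind: h; elim/Z4_ind: h';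
  rewrite ?Z4_neq ?eqxx /=; lia.
Qed.

Section Taxi.
Variable A : {fset Z2}.
Notation nxt := (nxt A).

Lemma positions_traject x0 e n :
  scanl +%R (taxi_pos x0 e) (map step (map (heading A) (traject nxt e n))) =
  map (taxi_pos x0) (traject nxt (nxt e) n).
Proof. by elim: n e => //= n IH e; rewrite -taxi_pos_nxt IH. Qed.

(** The taxi walk turns exactly when the contour makes two equal turns in a row, and goes straight
    when they alternate. So two left turns of the taxi walk are three left turns of the contour. *)
Lemma heading_sub e : heading A (nxt e) - heading A e =
  if (turn_right e).1 \in A
  then (if (turn_right (nxt e)).1 \in A then -1 else 0)
  else (if (turn_right (nxt e)).1 \in A then 0 else 1).
Proof.
case: ifP => rA.
  have -> : nxt e = turn_right e by rewrite /nxt rA.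
  rewrite /heading rA; case: ifP => _; first by rewrite addrC addKr.
  by rewrite subrK subrr.
have -> : nxt e = turn_left e by rewrite /nxt rA.
rewrite /heading rA; case: ifP => _; first by rewrite subrr.
by rewrite addrC addKr.
Qed.

Lemma infix_turns (t : 'Z_4) e n :
  infix [:: t; t] (turns (map (heading A) (traject nxt e n))) ->
  exists i, [/\ (i + 2 < n)%N,
    heading A (iter i.+1 nxt e) - heading A (iter i nxt e) = t &
    heading A (iter i.+2 nxt e) - heading A (iter i.+1 nxt e) = t].
Proof.
case: n => // n; rewrite /turns /=; set s := pairmap _ _ _.
have sE i : (i < n)%N -> nth 0 s i =
    heading A (iter i.+1 nxt e) - heading A (iter i nxt e).
  move=> lin; rewrite (nth_pairmap 0) ?size_map ?size_traject //.
  rewrite (nth_map (nxt e)) ?size_traject // nth_traject // -iterSr.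
  case: i lin => //= i lin; rewrite (nth_map (nxt e)) ?size_traject 1?ltnW //.
  by rewrite nth_traject 1?ltnW // -iterSr.
have ss : size s = n by rewrite size_pairmap size_map size_traject.
case/infixP => p1 [p2 sp]; exists (size p1).
have ln : (size p1 + 2 <= n)%N by rewrite -ss sp !size_cat /= addnA leq_addr.
have n1 : nth 0 s (size p1) = t by rewrite sp nth_cat ltnn subnn.
have n2 : nth 0 s (size p1).+1 = t.
  by rewrite sp nth_cat ltnNge leqnSn /= subSn // subnn.
by split; [lia|rewrite -[RHS]n1 sE //; lia|rewrite -[RHS]n2 sE //; lia].
Qed.

Variable q : bool.
Hypothesis bd_parity : forall e, bd A e -> parity e.1 = q.
Hypothesis no_isolated : forall x, x \in A -> exists d, x + step d \in A.

Lemma no_three_left e : bd A e ->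
  (turn_right e).1 \notin A -> (turn_right (nxt e)).1 \notin A ->
  (turn_right (nxt (nxt e))).1 \in A.
Proof.
move=> be n1 n2; apply: contraT => n3.
have b2 := bd_nxt bd_parity be; have b3 := bd_nxt bd_parity b2.
have b4 := bd_nxt bd_parity b3.
have E1 : nxt e = turn_left e by rewrite /nxt (negPf n1).
have E2 : nxt (nxt e) = turn_left (nxt e) by rewrite {1}/nxt (negPf n2).
have E3 : nxt (nxt (nxt e)) = turn_left (nxt (nxt e)) by rewrite {1}/nxt (negPf n3).
have /andP[xA y1] := be; have [d] := no_isolated xA.
move: b2 b3 b4 y1; rewrite E3 E2 E1 /bd xA /right_site /=.
case: e {be n1 n2 n3 E1 E2 E3 xA} => x h /= y2 y3 y4 y1.
have : d \in [:: h; h + 1; h + 1 + 1; h + 1 + 1 + 1].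
  by elim/Z4_ind: h {y1 y2 y3 y4}; elim/Z4_ind: d.
by rewrite !inE => /or4P[] /eqP-> xd;
  [move: y1|move: y2|move: y3|move: y4]; rewrite xd ?andbF.
Qed.

Lemma three_right e :
  e.1 \in A -> (turn_right e).1 \in A -> (turn_right (nxt e)).1 \in A ->
  (turn_right (nxt (nxt e))).1 \in A -> iter 4 nxt e = e.
Proof.
move=> eA n1 n2 n3.
have E1 : nxt e = turn_right e by rewrite /nxt n1.
have E2 : nxt (nxt e) = turn_right (nxt e) by rewrite {1}/nxt n2.
have E3 : nxt (nxt (nxt e)) = turn_right (nxt (nxt e)) by rewrite {1}/nxt n3.
rewrite /= E3 E2 E1 {1}/nxt; have := turn_right4 e.
by move: (turn_right (turn_right _)) => e2 E; rewrite E eA.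
Qed.

Variables (x0 : Z2) (p : nat).
Hypothesis be0 : bd A (x0, 0).
Hypothesis p_gt4 : (4 < p)%N.
Hypothesis g_uniq : uniq (traject nxt (x0, 0) p).
Hypothesis g_closed : iter p nxt (x0, 0) = (x0, 0).

(** A contour of [p] dual edges visits [p] midpoints, hence has [p - 1] headings: the closing step
    is dropped because it would revisit the start. *)
Let word := map (heading A) (traject nxt (x0, 0) p.-1).

Lemma contour_word : contour x0 word = traject nxt (x0, 0) p.
Proof. by rewrite /contour scanl_turn -[in RHS](ltn_predK p_gt4). Qed.

Lemma taxi_walk_word : taxi_walk word.
Proof.
pose e0 : state := (x0, 0).
have par i : parity (iter i nxt e0).1 = parity x0.
  rewrite (bd_parity (bd_iter bd_parity i be0)).
  by rewrite -(bd_parity be0).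
have pos0 : taxi_pos x0 e0 = 0 by rewrite /taxi_pos /= !subrr.
have posE : positions word = map (taxi_pos x0) (traject nxt (nxt e0) p.-1).
  by rewrite /positions -pos0 positions_traject.
apply/and4P; split.
- rewrite posE -pos0; move: (p.-1) => k {posE}.
  have : exists i, e0 = iter i nxt e0 by exists 0%N.
  move: {1 3 4}e0 => e; elim: k e => //= k IH e [i ei].
  rewrite IH ?andbT; last by exists i.+1; rewrite ei.
  rewrite taxi_pos_nxt ei taxi_pos_manhattan ?par //.
  by rewrite /heading; case: ifP; [left|right].
- rewrite posE -pos0 -[_ :: _]/(map (taxi_pos x0) (traject nxt e0 p.-1.+1)).
  rewrite (ltn_predK p_gt4) map_inj_in_uniq // => e e' /trajectP[i _ ->].
  by case/trajectP=> j _ ->; apply: taxi_pos_inj; apply: par.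
- apply/negP => /infix_turns[i [_]]; rewrite !iterS !heading_sub.
  have bi := bd_iter bd_parity i be0; move: (iter i nxt e0) bi => e be.
  have := no_three_left be.
  by case: ((turn_right e).1 \in A); case: ((turn_right (nxt e)).1 \in A) => //=;
    case: (_ \in A) => // H; have := H isT isT.
- apply/negP => /infix_turns[i [ip]]; rewrite !iterS !heading_sub => r1 r2.
  suff : iter 4 nxt (iter i nxt e0) = iter i nxt e0.
    rewrite -iterD add4n => E.
    have lt_nth a b : (a < p)%N -> (b < p)%N ->
        iter a nxt e0 = iter b nxt e0 -> a = b.
      move=> ap bp ab; apply/eqP; rewrite -(nth_uniq e0 _ _ g_uniq) ?size_traject //.
      by rewrite !nth_traject // ab.
    (* If [i + 4 < p] the repetition contradicts uniqueness. The infix only gives [i + 4 <= p], and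
       [p = i + 4] forces [i = 0], so [p = 4]. *)
    have [l|l] := ltnP i.+4 p; first by have := lt_nth _ _ l _ E; lia.
    have pi : p = i.+4 by lia.
    by have := lt_nth 0%N i; rewrite -E -pi g_closed => /(_ _ _ erefl); lia.
  have /andP[eA _] := bd_iter bd_parity i be0.
  move: r1 r2 eA; move: (iter i nxt e0) => e r1 r2 eA; apply: three_right => //.
  + by move: r1; do 2 case: ifP.
  + by move: r1; do 2 case: ifP.
  + by move: r2; do 2 case: ifP.
Qed.
End Taxi.

Definition box (n : nat) : {fset Z2} :=
  let r := [seq i%:Z - n%:Z | i <- iota 0 (n + n).+1] in
  seq_fset tt [seq (a, b) | a <- r, b <- r].

Lemma in_boxE n u : (u \in box n) = in_box n u.
Proof.
have rE (a : int) : (a \in [seq i%:Z - n%:Z | i <- iota 0 (n + n).+1]) =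
    (`|a| <= n)%N.
  apply/mapP/idP => [[i]|an]; first by rewrite mem_iota => ? ->; lia.
  by exists `|(a + n%:Z)%R|%N; rewrite ?mem_iota; lia.
rewrite seq_fsetE; apply/allpairsP/idP => [[[a b] [+ + ->]]|/andP[u1 u2]].
  by rewrite !rE /in_box /= => -> ->.
by exists u; rewrite !rE u1 u2; split=> //; case: (u).
Qed.

Definition encloses (g : seq state) (C : {fset Z2}) : Prop :=
  uniq g /\ forall (u : Z2) (d : 'Z_4), ((u, d) \in g) = (u \in C) && (u + step d \notin C).

(** The distant site [w] excludes short contours and isolated sites: a contour of length [p]
    confines [A] to a box of radius [p] around [x0], so [p <= 4] would put [w] within 8 of [v]. The
    same estimate, kept as the last clause, later bounds contour lengths from below. *)
Lemma contour_exists (A : {fset Z2}) q n (v w : Z2) :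
  (forall e, bd A e -> parity e.1 = q) ->
  (forall x : Z2, x \in A -> in_box n x) ->
  (forall x : Z2, x \in A -> linked (fun x => x \in A) v x) ->
  w \in A -> ~~ in_box 10 (w - v) ->
  exists x0 s C, [/\ taxi_walk s, in_box (size s).+1 (x0 - v),
    encloses (contour x0 s) C,
    (forall x, x \in C -> in_box n x) /\
    (forall e, e \in contour x0 s -> bd A e) &
    forall x, x \in A -> in_box ((size s).+1 + (size s).+1) (x - v)].
Proof.
move=> bdq Abox Alink wA wv.
have vA : v \in A by exact: linked_left (Alink _ wA).
(* Abscissas are shifted by [n] to become natural numbers bounded by [2 n], among which a maximum
   exists. *)
have [x0 x0A x0max] : exists2 x0, x0 \in A & forall x : Z2, x \in A -> x.1 <= x0.1.
  pose r := [seq x.1 | x <- enum_fset A].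
  pose P k := has (fun x : Z2 => x.1 == k%:Z - n%:Z) (enum_fset A).
  have exP : exists k, P k.
    exists `|(v.1 + n%:Z)%R|%N; apply/hasP; exists v => //.
    by have := Abox _ vA; rewrite /in_box; case: (v) => a b /=; lia.
  have ubP k : P k -> (k <= n + n)%N.
    case/hasP => x xA /eqP; have := Abox _ xA.
    by rewrite /in_box; case: x {xA} => a b /=; lia.
  case: (ex_maxnP exP ubP) => k /hasP[x0 x0A /eqP x0k] kmax.
  exists x0 => // x xA; have := kmax `|(x.1 + n%:Z)%R|%N; have := Abox _ xA.
  have -> : P `|(x.1 + n%:Z)%R|%N = in_box n x.
    rewrite Abox //; apply/hasP; exists x => //.
    by have := Abox _ xA; rewrite /in_box; case: (x) => a b /=; lia.
  move: x0k => ->; rewrite /in_box; case: (x) => a b /=; lia.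
have x0l x : x \in A -> linked (fun x => x \in A) x0 x.
  by move=> xA; apply: linked_trans (Alink _ xA); apply/linked_sym/Alink.
have be0 := bd_e0 x0A x0max.
have [p [p_gt0 g_uniq g_closed]] := orbit_exists bdq be0.
set g := traject _ _ _ in g_uniq.
have w1 x : x \in A -> winding g x = 1.
  by move=> xA; apply: (winding_linked bdq) => //; exact: x0l.
have near x : x \in A -> in_box p (x - x0).
  by move=> xA; apply: (@winding_near A q) Abox _ _; rewrite // -/g w1.
have far x y : x \in A -> y \in A -> in_box (p + p) (x - y).
  move=> /near + /near; rewrite /in_box.
  by case: (x) (y) (x0) => a b [c d] [e f] /=; lia.
have p_gt4 : (4 < p)%N.
  have := far _ _ wA vA; move: wv; rewrite /in_box.
  by case: (w) (v) => a b [c d] /=; lia.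
have niso x : x \in A -> exists d, x + step d \in A.
  move=> xA; have [y yA yx] : exists2 y, y \in A & y != x.
    have [vx|] := eqVneq v x; last by exists v.
    by exists w => //; apply: contraNneq wv => ->; rewrite vx subrr.
  have : linked (fun x => x \in A) y x.
    by apply: linked_trans (Alink _ xA); apply/linked_sym/Alink.
  case/linked_last => [yE|[z zA /lattice_adjP[d zE]]]; first by rewrite yE eqxx in yx.
  by exists d; rewrite -zE.
exists x0, (map (heading A) (traject (nxt A) (x0, 0) p.-1)).
rewrite size_map size_traject (ltn_predK p_gt4).
rewrite contour_word // -/g.
have wbox (u : Z2) : 0 < winding g u -> in_box n u.
  by apply: (@winding_box A q) => // e; exact: x0max.
pose C := [fset u in box n | 0 < winding g u]%fset.
have CE u : (u \in C) = (0 < winding g u).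
  rewrite !inE /= in_boxE andb_idl //; exact: wbox.
exists C; split.
- exact: (taxi_walk_word bdq).
- have := near _ vA; rewrite /in_box; case: (x0) (v) => a b [c d] /=; lia.
- by split=> // u d; rewrite !CE (winding_gt0_step bdq).
- split=> [x|e]; last exact: (orbit_bd bdq).
  by rewrite CE; exact: wbox.
- by move=> x xA; exact: far.
Qed.

Lemma cluster_contour (S : Z2 -> Prop) q n v w :
  (forall x, linked S v x -> in_box n x) ->
  (forall x d, linked S v x -> ~ S (x + step d) -> parity x = q) ->
  linked S v w -> ~~ in_box 10 (w - v) ->
  exists x0 s C, [/\ taxi_walk s, in_box (size s).+1 (x0 - v),
    encloses (contour x0 s) C,
    (forall x, x \in C -> in_box n x) /\
    (forall e, e \in contour x0 s -> [/\ linked S v e.1,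
       ~ S (right_site e) & parity e.1 = q]) &
    forall x, linked S v x -> in_box ((size s).+1 + (size s).+1) (x - v)].
Proof.
move=> Sbox Sq vw wv.
pose A := [fset x in box n | `[< linked S v x >]]%fset.
have AE x : (x \in A) = `[< linked S v x >].
  by rewrite !inE /= in_boxE andb_idl // => /asboolP /Sbox.
have bdS e : bd A e -> [/\ linked S v e.1, ~ S (right_site e) & parity e.1 = q].
  rewrite /bd !AE => /andP[/asboolP ve /asboolP vye].
  suff nS : ~ S (right_site e) by split=> //; exact: Sq nS.
  move=> Sy; apply: vye; apply: linked_next ve Sy _.
  by apply/lattice_adjP; exists e.2.
have linkA x : linked S v x -> linked (fun x => x \in A) v x.
  elim=> [Sv|y z vy Iy Sz yz].
    by apply: linked_refl; rewrite AE; apply/asboolP; exact: linked_refl.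
  by apply: (linked_next Iy _ yz); rewrite AE; apply/asboolP; exact: linked_next yz.
have [||||x0 [s [C [ts xv enc [CB bA] far]]]] := @contour_exists A q n v w _ _ _ _ wv.
- by move=> e /bdS[].
- by move=> x; rewrite AE => /asboolP; exact: Sbox.
- by move=> x; rewrite AE => /asboolP; exact: linkA.
- by rewrite AE; apply/asboolP.
exists x0, s, C; split=> //.
  by split=> // e /bA /bdS.
by move=> x vx; apply: far; rewrite AE; apply/asboolP.
Qed.

(** * Peierls' shift argument *)

Definition overlay (L J : {fset Z2}) (I : set Z2) : set Z2 :=
  ([set` J] `|` (I `\` [set` L]))%classic.

Lemma sum_subseq_le (T : eqType) (R : numDomainType) (s t : seq T) (f : T -> R) :
  uniq s -> uniq t -> {subset s <= t} -> (forall x, x \in t -> 0 <= f x) ->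
  \sum_(x <- s) f x <= \sum_(x <- t) f x.
Proof.
move=> us ut st f0.
have pst : perm_eq [seq x <- t | x \in s] s.
  apply: uniq_perm; rewrite ?filter_uniq // => x.
  by rewrite mem_filter andb_idr //; exact: st.
rewrite -(perm_big _ pst) big_filter [X in _ <= X](bigID (mem s)) /= lerDl.
by rewrite big_seq_cond sumr_ge0 // => x /andP[xt _]; exact: f0.
Qed.

Lemma big_fpowersetU (K : choiceType) (R : nmodType) (A B : {fset K})
    (f : {fset K} -> R) : [disjoint A & B]%fset ->
  \sum_(J <- fpowerset (A `|` B)%fset) f J =
  \sum_(M <- fpowerset A) \sum_(N <- fpowerset B) f (M `|` N)%fset.
Proof.
move=> dAB; rewrite -(@big_allpairs_dep _ _ _ _ _ _
  (@fsetU K) _ (fun _ => fpowerset B)).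
have capA M N : M \in fpowerset A -> N \in fpowerset B ->
    ((M `|` N) `&` A = M)%fset /\ ((M `|` N) `&` B = N)%fset.
  rewrite !fpowersetE => MA NB; rewrite !fsetIUl.
  rewrite (fsetIidPl MA) (fsetIidPl NB); split.
    rewrite (_ : N `&` A = fset0)%fset ?fsetU0 //; apply/eqP.
    by rewrite -fsubset0 -(eqP dAB) fsetIC fsetIS.
  rewrite (_ : M `&` B = fset0)%fset ?fset0U //; apply/eqP.
  by rewrite -fsubset0 -(eqP dAB) fsetSI.
apply: perm_big; apply: uniq_perm; first exact: fset_uniq.
  apply: allpairs_uniq; rewrite ?fset_uniq // => -[M N] [M' N'].
  move=> /allpairsP[[? ?] /= [MA NB [-> ->]]] /allpairsP[[? ?] /= [MA' NB' [-> ->]]].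
  have [M1 N1] := capA _ _ MA NB; have [M2 N2] := capA _ _ MA' NB' => /= E.
  by congr (_, _); [rewrite -[LHS]M1 E M2|rewrite -[LHS]N1 E N2].
move=> J; rewrite fpowersetE; apply/idP/allpairsP => [JAB|[[M N] /= [MA NB ->]]].
  exists (J `&` A, J `&` B)%fset; rewrite /= !fpowersetE !fsubsetIr.
  by rewrite -fsetIUr (fsetIidPl JAB).
by move: MA NB; rewrite !fpowersetE; exact: fsetUSS.
Qed.

Lemma sum_fpowerset_exp (K : choiceType) (R : comRingType) (x : R) (A : {fset K}) :
  \sum_(J <- fpowerset A) x ^+ #|` J| = (1 + x) ^+ #|` A|.
Proof.
elim/finSet_rect: A => A IH; have [->|[a aA]] := fset_0Vmem A.
  by rewrite fpowerset0 big_seq_fset1 cardfs0.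
have dA : [disjoint [fset a] & A `\ a]%fset by rewrite fdisjoint1X !inE eqxx.
rewrite -{1}(fsetD1K aA) big_fpowersetU // fpowerset1.
rewrite big_fsetU1 /= ?big_seq_fset1 ?inE; last first.
  by apply/eqP => /fsetP/(_ a); rewrite !inE eqxx.
rewrite (cardfsD1 a) aA add1n exprS mulrDl mul1r -IH ?fproperD1 //.
congr (_ + _); first by apply: eq_bigr => N _; rewrite fset0U.
rewrite mulr_sumr !big_seq; apply: eq_bigr => N; rewrite fpowersetE => NA.
rewrite cardfsU1 (_ : a \in N = false) ?exprS //.
by apply/negP => /(fsubsetP NA); rewrite !inE eqxx.
Qed.

Section FiniteVolume.
Variables (R : realType) (lambda : R).
Hypothesis lambda_gt0 : 0 < lambda.

(* The unnormalized probability of [E] in the box [L] with boundary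
   condition [I]. *)
Definition hc_sum (L : {fset Z2}) (I : config) (E : set (set Z2)) : R :=
  \sum_(J <- fpowerset L | `[< E (overlay L J (val I)) >]) hc_weight lambda L I J.

Lemma hc_weight_ge0 L I J : 0 <= hc_weight lambda L I J.
Proof. by rewrite /hc_weight; case: ifP => // _; rewrite exprn_ge0 // ltW. Qed.

Lemma hc_sumE L I (E : set (set Z2)) : hc_sum L I E = \sum_(J <- fpowerset L |
  `[< independent (overlay L J (val I)) >] && `[< E (overlay L J (val I)) >])
  lambda ^+ #|` J|.
Proof.
rewrite /hc_sum big_mkcond [RHS]big_mkcond; apply: eq_bigr => J _.
by rewrite /hc_weight /compatible /overlay; do 2 case: `[< _ >].
Qed.

Lemma hc_sum_gt0 L I : 0 < hc_sum L I setT.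
Proof.
rewrite /hc_sum (eq_bigl xpredT); last by move=> J; apply/asboolP.
rewrite (bigD1_seq fset0) ?fpowersetE ?fsub0set ?fset_uniq //=.
rewrite ltr_pwDl ?sumr_ge0 // => [|J _]; last exact: hc_weight_ge0.
rewrite /hc_weight cardfs0 expr0 asboolT // => u v [//|[Iu _]] [//|[Iv _]].
by have := valP I; rewrite inE => /(_ u v Iu Iv).
Qed.

Definition avoids (g : seq state) : set (set Z2) :=
  [set I | forall e, e \in g -> ~ I e.1 /\ ~ I (right_site e)]%classic.

Lemma peierls (L C : {fset Z2}) (I : config) (g : seq state) q :
  encloses g C -> (C `<=` L)%fset -> (forall e, e \in g -> parity e.1 = q) ->
  exists2 f : nat, (size g <= 4 * f)%N &
    hc_sum L I (avoids g) * (1 + lambda) ^+ f <= hc_sum L I setT.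
Proof.
move=> [g_uniq gE] CL gq.
pose F (d : 'Z_4) := [fset u in C | (u + step d)%R \notin C]%fset.
have FE d u : (u \in F d) = ((u, d) \in g) by rewrite !inE gE.
(* Pigeonhole over the four directions: each edge of [g] is counted in one [F d]. *)
have [d dF] : exists d, (size g <= 4 * #|` F d|)%N.
  apply/existsP; apply: contraT; rewrite negb_exists => /forallP allF.
  have : (size g <= \sum_(d : 'Z_4) #|` F d|)%N.
    have : {subset g <= flatten [seq [seq (u, d) | u <- enum_fset (F d)] | d <- enum 'Z_4]}.
      move=> [u d] ug; apply/flattenP; exists [seq (u, d) | u <- enum_fset (F d)].
        by apply/mapP; exists d; rewrite ?mem_enum.
      by apply/mapP; exists u; rewrite // FE.
    move/(uniq_leq_size g_uniq); rewrite size_flatten /shape -map_comp sumnE.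
    rewrite big_map big_enum /=; congr (_ <= _)%N; apply: eq_bigr => d _.
    by rewrite /= size_map.
  have : (\sum_(d : 'Z_4) (4 * #|` F d|).+1 <= \sum_(d : 'Z_4) size g)%N.
    by apply: leq_sum => d _; rewrite ltnNge allF.
  under eq_bigr do rewrite -addn1.
  rewrite big_split /= -big_distrr !sum_nat_const /= !card_ord /Zp_trunc /=.
  by move: (\sum_(i : 'Z_4) _)%N => k; lia.
exists #|` F d| => //.
have injd : injective (fun x : Z2 => x - step d).
  by move=> x y; exact: (@addIr _ (- step d)).
pose T (J : {fset Z2}) := [fset (x - step d)%R | x in (J `&` C)%fset]%fset.
pose Psi (J S : {fset Z2}) := (J `\` C `|` T J `|` S)%fset.
have TE J (x : Z2) : (x \in T J) = (x + step d \in J) && (x + step d \in C).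
  apply/imfsetP/idP => [[y /=]|xJC]; first by rewrite inE => ? ->; rewrite subrK.
  by exists (x + step d); rewrite ?addrK //= inE.
pose ok (J : {fset Z2}) := `[< independent (overlay L J (val I)) >].
(* Inner sites of [g] are empty, so all neighbors of a particle in [C] are in [C]; in particular the
   shift does not leave [C]. *)
have in_C J x e : `[< avoids g (overlay L J (val I)) >] -> x \in J -> x \in C ->
    x + step e \in C.
  move=> /asboolP av xJ xC; apply: contraT => xeC.
  have xg : (x, e) \in g by rewrite gE xC.
  by have [nx _] := av _ xg; case: nx; left.
have PsiE J S x : (x \in Psi J S) = (x \in J) && (x \notin C) || (x \in T J) || (x \in S).
  by rewrite /Psi 2!in_fsetU in_fsetD [(x \notin C) && _]andbC.
have TC J (x : Z2) : `[< avoids g (overlay L J (val I)) >] -> x \in T J -> x \in C.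
  rewrite TE => av /andP[xJ xC]; have := in_C J _ (d + 1 + 1) av xJ xC.
  by rewrite stepSS addrK.
have TF J (x : Z2) : x \in T J -> x \notin F d.
  by rewrite TE FE gE => /andP[_ ->]; rewrite andbF.
have FC x : x \in F d -> x \in C by rewrite FE gE => /andP[].
rewrite !hc_sumE -sum_fpowerset_exp -[X in X * _]big_filter -[X in _ <= X]big_filter.
set js := [seq J <- _ | _]; set ks := [seq J <- _ | _].
have jsP J : J \in js -> [/\ ok J, `[< avoids g (overlay L J (val I)) >] & (J `<=` L)%fset].
  by rewrite mem_filter fpowersetE => /andP[/andP[]].
have cardPsi J S : J \in js -> S \in fpowerset (F d) ->
    #|` Psi J S| = (#|` J| + #|` S|)%N.
  move=> /jsP[_ av _]; rewrite fpowersetE => /fsubsetP SF.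
  rewrite /Psi cardfsU (_ : _ `&` S = fset0)%fset ?cardfs0 ?subn0; last first.
    apply/fsetP => x; rewrite in_fset0 in_fsetI in_fsetU in_fsetD.
    apply/negP => /andP[/orP[/andP[xC _]|/TF xF] /SF xS].
      by rewrite FC in xC.
    by rewrite xS in xF.
  rewrite cardfsU (_ : _ `&` T J = fset0)%fset ?cardfs0 ?subn0; last first.
    apply/fsetP => x; rewrite in_fset0 in_fsetI in_fsetD.
    by apply/negP => /andP[/andP[xC _] /(TC _ _ av)]; rewrite (negPf xC).
  rewrite (card_imfset _ _ injd) /=.
  by congr (_ + _)%N; rewrite addnC cardfsID.
rewrite [X in X <= _](_ : _ =
    \sum_(J <- js) \sum_(S <- fpowerset (F d)) lambda ^+ #|` Psi J S|); last first.
  rewrite mulr_suml big_seq [RHS]big_seq; apply: eq_bigr => J Jjs.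
  rewrite mulr_sumr big_seq [RHS]big_seq; apply: eq_bigr => S SF.
  by rewrite cardPsi // exprD.
rewrite -(@big_allpairs_dep _ _ _ _ _ _ Psi _ (fun _ => fpowerset (F d))
  (fun K => lambda ^+ #|` K|)).
apply: sum_subseq_le.
- apply: allpairs_uniq; rewrite ?filter_uniq ?fset_uniq // => -[J S] [J' S'].
  move=> /allpairsP[[? ?] /= [/jsP[_ avJ _] SF [-> ->]]].
  move=> /allpairsP[[? ?] /= [/jsP[_ avJ' _] SF' [-> ->]]] /= /fsetP E.
  move: E SF SF' avJ avJ'; move: {J S J' S'}(J) (S) (J') (S') => J S J' S' E.
  rewrite !fpowersetE => /fsubsetP SF /fsubsetP SF' avJ avJ'.
  (* Decoding: the added set is the part of [Psi K U] in [F d]. Outside [C] nothing was changed, and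
     inside [C] the rest is shifted back. *)
  have key (x : Z2) K U : {subset U <= F d} -> `[< avoids g (overlay L K (val I)) >] ->
      (x \in U = (x \in F d) && (x \in Psi K U)) /\
      (x \in K = if x \in C then (x - step d \in C) && (x - step d \in Psi K U)
                 else x \in Psi K U).
    move=> UF av; rewrite !PsiE; split.
      have [xF|xF] := boolP (x \in F d); last by apply/negP => /UF; rewrite (negPf xF).
      by rewrite FC // andbF /= (contraTF (@TF K x)) ?xF.
    case: ifP => xC; last first.
      rewrite xC andbT; have [//|xK] := boolP (x \in K).
      apply/esym/negbTE; rewrite /= negb_or; apply/andP; split.
        by apply/negP => /(TC _ _ av); rewrite xC.
      by apply/negP => /UF /FC; rewrite xC.
    have yF : x - step d \notin F d by rewrite FE gE subrK xC andbF.
    have yU : x - step d \notin U by apply: contra yF; exact: UF.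
    rewrite (negPf yU) orbF; have [yC|yC] := boolP (x - step d \in C).
      by rewrite andbF /= TE subrK xC andbT.
    apply/negP => xK; move/negP: yC; apply; apply: (TC K) av _.
    by rewrite TE subrK xC xK.
  congr (_, _); apply/fsetP => x.
    by have [_ ->] := key x _ _ SF avJ; have [_ ->] := key x _ _ SF' avJ'; rewrite !E.
  by have [-> _] := key x _ _ SF avJ; have [-> _] := key x _ _ SF' avJ'; rewrite !E.
- by rewrite filter_uniq ?fset_uniq.
- move=> K /allpairsP[[J S] /= [/jsP[okJ av JL]]].
  rewrite fpowersetE => /fsubsetP SF ->.
  rewrite mem_filter fpowersetE; apply/andP; split; last first.
    apply/fsubsetP => x; rewrite PsiE => /orP[/orP[/andP[xJ _]|/(TC _ _ av)]|/SF /FC].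
    + exact: (fsubsetP JL).
    + exact: (fsubsetP CL).
    + exact: (fsubsetP CL).
  apply/andP; split; last exact/asboolP.
  apply/asboolP; move/asboolP: (okJ) => indJ; move/asboolP: (av) => avJ.
  have cls u : overlay L (Psi J S) (val I) u ->
      [\/ overlay L J (val I) u /\ u \notin C, u \in T J | u \in S].
    rewrite /overlay /= => -[|[Iu uL]].
      rewrite PsiE => /orP[/orP[/andP[uJ uC]|uT]|uS].
      + by apply: Or31; split=> //; left.
      + exact: Or32.
      + exact: Or33.
    apply: Or31; split; first by right.
    by apply: contra_notN uL => /(fsubsetP CL).
  (* A neighbor outside [C] of a site of [C] is the right site of an edge of [g], hence empty. *)
  have cross w u : w \in C -> overlay L J (val I) u -> u \notin C -> ~~ lattice_adj w u.
    move=> wC Iu uC; apply/negP => /lattice_adjP[e uE].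
    have wg : (w, e) \in g by rewrite gE wC -uE.
    by have [_] := avJ _ wg; rewrite /right_site /= -uE.
  (* If [w] were a neighbor of [u], then [w + step d] would be a neighbor of the particle
     [u + step d] of [C], hence in [C], against [w \in F d]. *)
  have TS u w : u \in T J -> w \in S -> ~~ lattice_adj u w.
    rewrite TE => /andP[uJ uC] /SF; rewrite FE gE => /andP[_ /negP wC].
    apply/negP => /lattice_adjP[e wE]; apply: wC.
    by rewrite wE addrAC; apply: in_C av uJ uC.
  have SC u : u \in S -> u \in C by move/SF/FC.
  have Sq u : u \in S -> parity u = q by move/SF; rewrite FE => /gq.
  move=> u v /cls[[Iu uC]|uT|uS] /cls[[Iv vC]|vT|vS].
  + exact: indJ.
  + by rewrite lattice_adjC; apply: cross => //; exact: TC vT.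
  + by rewrite lattice_adjC; apply: cross => //; exact: SC.
  + by apply: cross => //; exact: TC uT.
  + have -> : lattice_adj u v = lattice_adj (u + step d) (v + step d).
      apply/lattice_adjP/lattice_adjP => -[e E]; exists e; first by rewrite E addrAC.
      by apply: (addIr (step d)); rewrite E addrAC.
    by move: uT vT; rewrite !TE => /andP[uJ _] /andP[vJ _]; apply: indJ; left.
  + exact: TS.
  + by apply: cross => //; exact: SC.
  + by rewrite lattice_adjC; exact: TS.
  + apply/negP => /lattice_adjP[e vE]; have := Sq _ vS.
    by rewrite vE parity_step Sq //; case: (q).
- by move=> K _; rewrite exprn_ge0 // ltW.
Qed.
End FiniteVolume.

(** * Counting contours *)

Lemma encloses_size g C : encloses g C -> (size g <= 4 * #|` C|)%N.
Proof.
case=> g_uniq gE.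
have /(uniq_leq_size g_uniq) : {subset g <= [seq (u, d) | d <- enum 'Z_4, u <- enum_fset C]}.
  move=> [u d]; rewrite gE => /andP[uC _]; apply/allpairsP.
  by exists (d, u); rewrite mem_enum.
by rewrite size_allpairs -cardE card_ord.
Qed.

Lemma card_box n : (#|` box n| <= (n + n).+1 ^ 2)%N.
Proof.
rewrite /box size_seq_fset (leq_trans (size_undup _)) //.
by rewrite size_allpairs size_map size_iota.
Qed.

Section Contours.
Variables (R : realType) (lambda : R).
Hypothesis lambda_gt0 : 0 < lambda.

Lemma hc_sum_union (T : eqType) (s : seq T) (L : {fset Z2}) (I : config)
    (E : set (set Z2)) (F : T -> set (set Z2)) :
  (forall J, (J `<=` L)%fset -> independent (overlay L J (val I)) -> E (overlay L J (val I)) ->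
    exists2 i, i \in s & F i (overlay L J (val I))) ->
  hc_sum lambda L I E <= \sum_(i <- s) hc_sum lambda L I (F i).
Proof.
move=> EF; rewrite /hc_sum big_mkcond /=.
under [X in _ <= X]eq_bigr do rewrite big_mkcond /=.
rewrite exchange_big /= big_seq [X in _ <= X]big_seq; apply: ler_sum => J.
rewrite fpowersetE => JL.
have w0 := hc_weight_ge0 lambda_gt0 L I J.
have s0 (t : seq T) : 0 <= \sum_(i <- t)
    (if `[< F i (overlay L J (val I)) >] then hc_weight lambda L I J else 0).
  by apply: sumr_ge0 => i _; case: ifP.
case: ifP => // /asboolP EJ.
rewrite {1}/hc_weight; case: ifP => // /asboolP cJ.
have [i /splitPr[s1 s2] /asboolP Fi] := EF _ JL cJ EJ.
rewrite big_cat big_cons /= Fi addrCA {1}/hc_weight asboolT //.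
by rewrite lerDl addr_ge0.
Qed.

(** The contour has [(size s).+1] edges and starts within that distance of [v], which leaves
    polynomially many starting sites for each length. *)
Definition contour_around (n : nat) (q : bool) (v : Z2) (p : nat) : set (set Z2) :=
  [set I | exists x0 s C, [/\ taxi_walk s, in_box (size s).+1 (x0 - v),
    encloses (contour x0 s) C /\ (p <= size s)%N,
    (C `<=` box n)%fset &
    (forall e, e \in contour x0 s -> parity e.1 = q) /\
    avoids (contour x0 s) I]]%classic.

Variable rho : R.
Hypothesis rho_gt0 : 0 < rho.
Hypothesis rhoE : rho ^+ 4 = 1 + lambda.

(** Starting sites in a box of radius [p + 1], times taxi walks of length [p], times the Peierls
    bound for a contour of [p + 1] edges. *)
Definition contour_weight (p : nat) : R :=
  ((p.+1 + p.+1).+1 ^ 2 * taxi_count p)%:R / rho ^+ p.+1.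

Lemma contour_around_sum n q v p I : exists M,
  hc_sum lambda (box n) I (contour_around n q v p) <=
  (\sum_(p <= k < M) contour_weight k) * hc_sum lambda (box n) I setT.
Proof.
(* A contour in the box has at most four edges per enclosed site, which caps the lengths in the
   union bound. *)
pose M := (4 * #|` box n|)%N; exists M.
pose Z := hc_sum lambda (box n) I setT.
have Z0 : 0 <= Z by rewrite ltW // hc_sum_gt0.
have rho1 : 1 <= rho.
  rewrite -(@ler_pXn2r _ 4 isT) ?nnegrE //; last exact: ltW.
  by rewrite rhoE expr1n lerDl ltW.
pose cands (k : nat) : seq (Z2 * seq 'Z_4) :=
  [seq (x + v, val s) | x <- enum_fset (box k.+1),
                        s <- enum [pred s : k.-tuple 'Z_4 | taxi_walk s]].
pose good x0 s := exists2 C, encloses (contour x0 s) C /\ (C `<=` box n)%fset &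
  forall e, e \in contour x0 s -> parity e.1 = q.
pose F (c : Z2 * seq 'Z_4) : set (set Z2) :=
  if `[< good c.1 c.2 >] then avoids (contour c.1 c.2) else set0.
have F_le (c : Z2 * seq 'Z_4) :
    hc_sum lambda (box n) I (F c) <= Z / rho ^+ (size c.2).+1.
  rewrite /F; case: asboolP => [[C [enc CB] gq]|_]; last first.
    rewrite /hc_sum big_pred0; last by move=> J; apply/asboolP.
    by rewrite divr_ge0 // exprn_ge0 // ltW.
  have [f gf pe] := peierls lambda_gt0 I enc CB gq.
  rewrite ler_pdivlMr ?exprn_gt0 //; apply: le_trans pe.
  apply: ler_wpM2l; first by apply: sumr_ge0 => J _; exact: hc_weight_ge0.
  rewrite -rhoE -exprM; apply: ler_weXn2l => //.
  by move: gf; rewrite /contour /= size_scanl.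
apply: (@le_trans _ _ (\sum_(c <- flatten [seq cands k | k <- index_iota p M])
    hc_sum lambda (box n) I (F c))).
  apply: hc_sum_union => J _ _ [x0 [s [C [ts xv [enc ps] CB [gq av]]]]].
  exists (x0, s); last first.
    by rewrite /F asboolT //; exists C.
  apply/flattenP; exists (cands (size s)).
    apply/mapP; exists (size s) => //; rewrite mem_index_iota ps /=.
    have := encloses_size enc; rewrite /contour /= size_scanl => sz.
    by rewrite (leq_trans sz) // /M leq_pmul2l // fsubset_leq_card.
  apply/allpairsP; exists (x0 - v, in_tuple s); rewrite subrK; split=> //=.
    by rewrite in_boxE.
  by rewrite mem_enum.
rewrite big_flatten big_map mulr_suml; apply: ler_sum => k _.
apply: (@le_trans _ _ (\sum_(c <- cands k) Z / rho ^+ k.+1)).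
  rewrite big_seq [X in _ <= X]big_seq; apply: ler_sum => c.
  by move=> /allpairsP[[x s] /= [_ _ ->]]; rewrite (le_trans (F_le _)) //= size_tuple.
rewrite big_const_seq count_predT iter_addr_0 size_allpairs -cardE.
rewrite -/(taxi_count k) /contour_weight -[X in X <= _]mulr_natl mulrA.
rewrite [X in _ <= X]mulrAC.
apply: ler_wpM2r => //; first by rewrite invr_ge0 exprn_ge0 // ltW.
apply: ler_wpM2r => //; rewrite ler_nat leq_mul2r; apply/orP; right.
exact: card_box.
Qed.
End Contours.

(** * Phases and escape events *)

Fact boundary_independent (q : bool) :
  [set x : Z2 | parity x = q]%classic \in independent.
Proof.
rewrite inE => u v /= uq vq; apply/negP => /lattice_adjP[d vE].
by move: vq; rewrite vE parity_step uq; case: (q).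
Qed.

Definition boundary (q : bool) : config :=
  exist _ [set x : Z2 | parity x = q]%classic (boundary_independent q).

(** The occupied sites of parity [q], thickened by their neighbors. For independent [I], an edge
    leaving this set has both ends empty: the inner one has parity [~~ q] and an occupied neighbor,
    the outer one has parity [q] and is not in the set. *)
Definition phase_set (q : bool) (I : set Z2) (x : Z2) : Prop :=
  if parity x == q then I x else exists d, I (x + step d).

(** A finite-range form of a large cluster of phase [q] meeting [box k]. As it depends on finitely
    many sites, its finite-volume bounds survive in the limiting measures. *)
Definition escape (q : bool) (k m : nat) : set (set Z2) :=
  [set I | exists v w d, [/\ in_box k v,
     linked (fun x => phase_set q I x /\ in_box m x) v w,
     ~~ in_box m (w + step d) & phase_set q I (w + step d)]]%classic.

Lemma linked_exit (S : Z2 -> Prop) m v u :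
  in_box m v -> linked S v u -> ~~ in_box m u ->
  exists w d, [/\ linked (fun x => S x /\ in_box m x) v w,
                  ~~ in_box m (w + step d) & S (w + step d)].
Proof.
move=> vm vu; suff [/linked_right[_ ->] //|//] : linked (fun x => S x /\ in_box m x) v u \/
  exists w d, [/\ linked (fun x => S x /\ in_box m x) v w,
                  ~~ in_box m (w + step d) & S (w + step d)].
elim: vu => [Sv|x y vx [IH|] Sy xy]; [by left; apply: linked_refl| |by right].
have [ym|ym] := boolP (in_box m y).
  by left; apply: (linked_next IH _ xy).
by right; have /lattice_adjP[d yE] := xy; exists x, d; rewrite -yE.
Qed.

Lemma linked_sub (S T : Z2 -> Prop) v u :
  (forall x, S x -> T x) -> linked S v u -> linked T v u.
Proof.
move=> ST; elim=> [/ST|x y _ vx /ST Ty xy]; first exact: linked_refl.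
exact: linked_next vx Ty xy.
Qed.

Section Phase.
Variables (q : bool) (n : nat) (I : set Z2).
Hypothesis I_ind : independent I.
Hypothesis I_bd : forall x, ~~ in_box n x -> I x <-> parity x = q.

Lemma occupied_step x d : I x -> ~ I (x + step d).
Proof.
by move=> Ix Iy; have := I_ind Ix Iy => /negP; apply; apply/lattice_adjP; exists d.
Qed.

Lemma not_phase_step r x d : parity x != r ->
  phase_set r I (x + step d) -> phase_set r I x.
Proof.
rewrite /phase_set => xr; rewrite parity_step (negPf xr).
by rewrite (_ : ~~ parity x == r) => [Iy|]; [exists d|case: (parity x) (r) xr => [] []].
Qed.

Lemma phase_unoccupied r x : parity x != r -> phase_set r I x -> ~ I x.
Proof.
rewrite /phase_set => /negPf-> [d Iy] Ix; exact: occupied_step Ix Iy.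
Qed.

Lemma not_phase_unoccupied r x : parity x = r -> ~ phase_set r I x -> ~ I x.
Proof. by rewrite /phase_set => ->; rewrite eqxx. Qed.

Lemma not_phase_step_parity r x d : phase_set r I x ->
  ~ phase_set r I (x + step d) -> parity x = ~~ r.
Proof.
move=> Sx; have [xr|xr _] := eqVneq (parity x) r; last by case: (parity x) (r) xr => [] [].
case; move: Sx; rewrite /phase_set parity_step xr eqxx => Ix.
rewrite (_ : ~~ r == r = false); last by case: (r).
by exists (d + 1 + 1); rewrite stepSS addrK.
Qed.

Lemma phase_out x : ~~ in_box n x -> phase_set q I x.
Proof.
move=> xn; rewrite /phase_set; case: eqVneq => [/I_bd|xq]; first exact.
(* A step away from the box stays outside it and reaches a site of parity [q]. *)
have [d dn] : exists d, ~~ in_box n (x + step d).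
  have : [\/ ~~ in_box n (x + step 0), ~~ in_box n (x + step 1),
             ~~ in_box n (x + step (1 + 1)) | ~~ in_box n (x + step (-1))].
    move: xn; rewrite /in_box; case: (x) => a b /=.
    have [] : [\/ (n < `|a|)%N /\ 0 <= a, (n < `|a|)%N /\ a <= 0,
       (n < `|b|)%N /\ 0 <= b | (n < `|b|)%N /\ b <= 0] \/ (`|a| <= n)%N && (`|b| <= n)%N.
      have [?|?] := leqP `|a| n; have [?|?] := leqP `|b| n; try (by right; apply/andP);
       left; have [?|?] := leP 0 a; have [?|?] := leP 0 b;
       by [apply: Or41; split; lia|apply: Or42; split; lia
          |apply: Or43; split; lia|apply: Or44; split; lia].
    - case=> -[? ?] _; [apply: Or41|apply: Or43|apply: Or42|apply: Or44];
        rewrite ?Z2E /=; lia.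
    - by move=> ->.
  by case=> ?; [exists 0|exists 1|exists (1 + 1)|exists (-1)].
exists d; apply/(I_bd dn); rewrite parity_step.
by case: (parity x) (q) xq => [] [].
Qed.

Lemma phase_in x : phase_set (~~ q) I x -> in_box n x.
Proof.
move=> Sx; apply: contraT => xn; move: Sx; rewrite /phase_set.
case: eqVneq => [xq|xq [d]]; first by move/(I_bd xn); rewrite xq; case: (q).
have Ix : I x by apply/(I_bd xn); case: (parity x) (q) xq => [] [].
by move/(occupied_step Ix).
Qed.

(** The boundary condition confines the cluster of phase [~~ q] to the box, so it has a contour. The
    cluster contains a site farther than [2 p + 12] from [v], which forces the contour to be
    long. *)
Lemma escape_contour k m p : (k + p + p + 12 <= m)%N -> escape (~~ q) k m I ->
  exists2 v, in_box k v & contour_around n q v p I.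
Proof.
move=> km [v [w [d [vk vw ym Sy]]]]; exists v => //.
pose u := w + step d.
have vu : linked (phase_set (~~ q) I) v u.
  apply: (@linked_next _ _ w) => //; last by apply/lattice_adjP; exists d.
  by apply: linked_sub vw => x [].
have uv r : (r + k <= m)%N -> ~~ in_box r (u - v).
  move: ym vk; rewrite -/u /in_box; case: (u) (v) => a b [c e] /=; lia.
have [|||x0 [s [C [ts xv enc [CB gS] far]]]] :=
    @cluster_contour (phase_set (~~ q) I) q n v u _ _ vu.
- by move=> x /linked_right; exact: phase_in.
- by move=> x e /linked_right Sx /(not_phase_step_parity Sx) ->; rewrite negbK.
- by apply: uv; lia.
exists x0, s, C; split => //.
- split=> //; have := far _ vu; apply: contraTT; rewrite -ltnNge => sp.
  by apply: uv; lia.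
- by apply/fsubsetP => x /CB; rewrite in_boxE.
- split=> [e /gS[]//|e /gS[/linked_right Se nS eq]]; split.
    by apply: phase_unoccupied Se; rewrite eq; case: (q).
  by apply: not_phase_unoccupied nS; rewrite /right_site parity_step eq.
Qed.

Lemma linked_axis (S : Z2 -> Prop) k : (forall x, in_box k x -> S x) ->
  linked S 0 (k%:Z, 0).
Proof.
move=> kS; suff H (i : nat) : (i <= k)%N -> linked S 0 (i%:Z, 0) by exact: H.
elim: i => [_|i IH ik]; first by apply: linked_refl; apply: kS; rewrite /in_box /=.
apply: linked_next (IH (ltnW ik)) _ _.
  by apply: kS; rewrite /in_box /=; lia.
by rewrite /lattice_adj /=; lia.
Qed.

(** [S] consists of the sites that phase [q] does not link to the exterior of the box; it contains
    [box k]. An edge leaving [S] enters the phase instead of leaving it, so its inner site has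
    parity [q], just as for clusters of the opposite phase. *)
Lemma no_escape_contour k m p : (p + p + 12 <= k)%N -> (k <= m)%N -> (m <= n)%N ->
  ~ escape q k m I -> contour_around n q 0 p I.
Proof.
move=> pk km mn nE.
pose S x := ~ exists2 y, ~~ in_box n y & linked (phase_set q I) x y.
have Sk x : in_box k x -> S x.
  move=> xk [y yn xy]; apply: nE; exists x.
  have xm : in_box m x by move: xk; rewrite /in_box; lia.
  have ym : ~~ in_box m y by apply: contra yn; rewrite /in_box; lia.
  by have [w [d [? ? ?]]] := linked_exit xm xy ym; exists w, d.
have Sn x : S x -> in_box n x.
  move=> Sx; apply: contraT => xn; case: Sx; exists x => //.
  by apply: linked_refl; exact: phase_out.
have nSstep x d : S x -> ~ S (x + step d) ->
    phase_set q I (x + step d) /\ ~ phase_set q I x.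
  move=> Sx /contrapT[y yn ly]; split; first exact: linked_left ly.
  move=> Px; apply: Sx; exists y => //; apply: (linked_trans _ ly).
  apply: (@linked_next _ _ x); first exact: linked_refl.
    exact: linked_left ly.
  by apply/lattice_adjP; exists d.
have Spar x d : S x -> ~ S (x + step d) -> parity x = q.
  move=> Sx Sy; have [Py nPx] := nSstep _ _ Sx Sy.
  apply/eqP; apply: contraT => xq; case: nPx; exact: not_phase_step Py.
have lk := linked_axis Sk.
have kf r : (r < k)%N -> ~~ in_box r ((k%:Z, 0) - 0 : Z2).
  by rewrite subr0 /in_box /=; lia.
have [|||x0 [s [C [ts xv enc [CB gS] far]]]] := @cluster_contour S q n 0 _ _ _ lk.
- by move=> x /linked_right; exact: Sn.
- by move=> x d /linked_right; exact: Spar.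
- by apply: kf; lia.
exists x0, s, C; split => //.
- split=> //; have := far _ lk; apply: contraTT; rewrite -ltnNge => sp.
  by apply: kf; lia.
- by apply/fsubsetP => x /CB; rewrite in_boxE.
- split=> [e /gS[]//|e /gS[/linked_right Se nS eq]].
  have [Py nPx] := nSstep _ _ Se nS; split; first exact: not_phase_unoccupied nPx.
  by apply: phase_unoccupied Py; rewrite parity_step eq; case: (q).
Qed.
End Phase.

(** * The connective constant *)

Definition taxi_walks (n : nat) : seq (seq 'Z_4) :=
  [seq val t | t <- enum [pred s : n.-tuple 'Z_4 | taxi_walk s]].

Lemma size_taxi_walks n : size (taxi_walks n) = taxi_count n.
Proof. by rewrite size_map -cardE. Qed.

Lemma taxi_walks_uniq n : uniq (taxi_walks n).
Proof. by rewrite map_inj_uniq ?enum_uniq //; exact: val_inj. Qed.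

Lemma mem_taxi_walks n s : (s \in taxi_walks n) = (size s == n) && taxi_walk s.
Proof.
apply/mapP/andP => [[t + ->]|[sn ts]].
  by rewrite mem_enum inE size_tuple eqxx.
by exists (Tuple sn); rewrite ?mem_enum.
Qed.

(* The reflections turning the Manhattan lattice seen from a vertex whose
   coordinates have parities [a] and [b] into the one seen from the origin. *)
Definition reflect_site (a b : bool) (u : Z2) : Z2 :=
  (if b then - u.1 else u.1, if a then - u.2 else u.2).

Definition reflect_heading (a b : bool) (d : 'Z_4) : 'Z_4 :=
  let d' := if b then 1 + 1 - d else d in if a then - d' else d'.

Lemma step_reflect a b d : step (reflect_heading a b d) = reflect_site a b (step d).
Proof. by elim/Z4_ind: d; case: a; case: b; apply/eqP; rewrite eq_Z2. Qed.

Lemma reflect_siteD a b u v :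
  reflect_site a b (u + v) = reflect_site a b u + reflect_site a b v.
Proof.
by apply/eqP; rewrite eq_Z2; case: u v => ? ? [? ?]; case: a; case: b => /=; lia.
Qed.

Lemma reflect_site_inj a b : injective (reflect_site a b).
Proof.
move=> [? ?] [? ?] /eqP; rewrite eq_Z2 => E; apply/eqP; move: E; rewrite eq_Z2.
by case: a; case: b => /=; lia.
Qed.

Lemma reflect_heading_inj a b : injective (reflect_heading a b).
Proof. by move=> d e /(congr1 step); rewrite !step_reflect => /reflect_site_inj /step_inj. Qed.

Lemma odd_absB (x y : int) : odd `|(x - y)%R| = odd `|x| (+) odd `|y|.
Proof. lia. Qed.

Lemma reflect_manhattan (x u v : Z2) :
  let R := reflect_site (odd `|x.1|%N) (odd `|x.2|%N) in
  manhattan u v -> manhattan (R (u - x)) (R (v - x)).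
Proof.
move: x u v => [x1 x2] [u1 u2] [v1 v2]; rewrite /manhattan /reflect_site /= !xpair_eqE.
have oE (b : bool) (k : int) : odd `|(if b then - k else k)%R|%N = odd `|k| .
  by case: b => //; rewrite abszN.
rewrite !oE.
rewrite !odd_absB; clear oE.
case: (odd `|x1|); case: (odd `|x2|); case: (odd `|u1|); case: (odd `|u2|);
  rewrite /= ?expr1 ?expr0; lia.
Qed.

Lemma scanl_reflect a b x y s :
  scanl +%R (reflect_site a b (y - x)) (map step (map (reflect_heading a b) s)) =
  map (fun u => reflect_site a b (u - x)) (scanl +%R y (map step s)).
Proof.
elim: s y => //= d s IH y; rewrite step_reflect -reflect_siteD.
by rewrite addrAC IH.
Qed.

(** A single reflection exchanges left and right turns, two reflections preserve them; the taxi
    condition is symmetric under the exchange. *)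
Lemma turns_reflect a b s :
  turns (map (reflect_heading a b) s) =
  map (fun d => if a (+) b then - d else d) (turns s).
Proof.
case: s => //= d s; rewrite /turns /=; elim: s d => //= e s IH d; rewrite IH.
congr (_ :: _); rewrite /reflect_heading; case: a {IH}; case: b => //=; ring.
Qed.

Lemma infix_map (T S : eqType) (f : T -> S) s t :
  infix s t -> infix (map f s) (map f t).
Proof. by case/infixP => s1 [s2 ->]; rewrite !map_cat infix_infix. Qed.

Lemma infix_turns_reflect a b s (t : 'Z_4) :
  infix [:: t; t] (turns (map (reflect_heading a b) s)) ->
  infix [:: t; t] (turns s) || infix [:: - t; - t] (turns s).
Proof.
rewrite turns_reflect => /(infix_map (fun d => if a (+) b then - d else d)).
rewrite -map_comp (_ : map _ (turns s) = turns s).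
  by case: (a (+) b) => /= ->; rewrite ?orbT.
by rewrite -[RHS]map_id; apply: eq_map => d /=; case: (a (+) b); rewrite ?opprK.
Qed.

Lemma last_scanl (T S : Type) (f : T -> S -> T) x s :
  last x (scanl f x s) = foldl f x s.
Proof. by elim: s x => //=. Qed.

Lemma infix_turns_cat s1 s2 :
  infix (turns s1) (turns (s1 ++ s2)) /\ infix (turns s2) (turns (s1 ++ s2)).
Proof.
case: s1 => [|d s1]; first by rewrite infix0s infix_refl.
rewrite /turns /= pairmap_cat prefix_infix; split=> //.
by case: s2 => [|e s2] /=; rewrite ?infix0s // -cat_rcons suffix_infix.
Qed.

Lemma taxi_walk_cat s1 s2 : taxi_walk (s1 ++ s2) ->
  let x := foldl +%R 0 (map step s1) in
  taxi_walk s1 /\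
  taxi_walk (map (reflect_heading (odd `|x.1|%N) (odd `|x.2|%N)) s2).
Proof.
move=> /and4P[+ + nL nR] x; set a := odd `|x.1|; set b := odd `|x.2|.
have [inf1 inf2] := infix_turns_cat s1 s2.
have posE : positions (map (reflect_heading a b) s2) =
    map (fun u => reflect_site a b (u - x)) (scanl +%R x (map step s2)).
  rewrite /positions -scanl_reflect subrr; congr scanl.
  by case: (a); case: (b).
have pos0 : 0 = reflect_site a b (x - x).
  by rewrite subrr; case: (a); case: (b).
rewrite /positions map_cat scanl_cat cat_path last_scanl -/x.
rewrite -cat_cons cat_uniq => /andP[p1 p2] /and3P[u1 /hasPn u12 u2].
split.
  apply/and4P; split=> //.
  - by apply: contra nL => /infix_trans; exact.
  - by apply: contra nR => /infix_trans; exact.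
apply/and4P; split.
- rewrite posE pos0 (@path_map _ _ (fun u => reflect_site a b (u - x))).
  by apply: sub_path p2 => u v; exact: reflect_manhattan.
- rewrite posE pos0 -[_ :: _]/(map (fun u => reflect_site a b (u - x)) (x :: _)).
  rewrite map_inj_uniq /=; last by move=> u v /reflect_site_inj /addIr.
  rewrite u2 andbT; apply/negP => /u12; rewrite /= -{1}[x]last_scanl.
  by rewrite mem_last.
- apply/negP => /infix_turns_reflect /orP[] h.
    by move/negP: nL; apply; exact: infix_trans h inf2.
  by move/negP: nR; apply; exact: infix_trans h inf2.
- apply/negP => /infix_turns_reflect; rewrite opprK => /orP[] h.
    by move/negP: nR; apply; exact: infix_trans h inf2.
  by move/negP: nL; apply; exact: infix_trans h inf2.
Qed.

(** A walk is cut after [m] steps and its tail normalized by the reflection belonging to the cut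
    vertex. The head determines this reflection, so the cutting is injective. *)
Lemma taxi_count_submul m n :
  (taxi_count (m + n) <= taxi_count m * taxi_count n)%N.
Proof.
pose r (s : seq 'Z_4) := let x := foldl +%R 0 (map step (take m s)) in
  reflect_heading (odd `|x.1|%N) (odd `|x.2|%N).
pose f s := (take m s, map (r s) (drop m s)).
rewrite -!size_taxi_walks -(size_allpairs pair) -(size_map f).
apply: uniq_leq_size.
  rewrite map_inj_in_uniq ?taxi_walks_uniq // => s t _ _ /eqP.
  rewrite xpair_eqE /= /r => /andP[/eqP st]; rewrite st => /eqP.
  by move/(inj_map (@reflect_heading_inj _ _)) => E; rewrite -(cat_take_drop m s) st E cat_take_drop.
move=> _ /mapP[s + ->]; rewrite mem_taxi_walks => /andP[/eqP sn ts].
apply/allpairsP; exists (f s); rewrite /f /= !mem_taxi_walks; split=> //.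
  rewrite size_take sn; case: ltnP => mn.
    by move: ts; rewrite -{1}(cat_take_drop m s) eqxx => /taxi_walk_cat [].
  rewrite (_ : (m + n)%N = m) ?eqxx; last by lia.
  by move: ts; rewrite -{1}(cat_take_drop m s) => /taxi_walk_cat [].
rewrite size_map size_drop sn addKn eqxx.
by move: ts; rewrite -{1}(cat_take_drop m s) => /taxi_walk_cat [].
Qed.

Lemma taxi_count_gt0 n : (0 < taxi_count n)%N.
Proof.
suff : nseq n (0 : 'Z_4) \in taxi_walks n.
  by rewrite -size_taxi_walks; case: (taxi_walks n).
rewrite mem_taxi_walks size_nseq eqxx /=.
have posE (k : nat) : scanl +%R ((k%:Z, 0) : Z2) (map step (nseq n 0)) =
    map (fun i : nat => (i%:Z, 0) : Z2) (iota k.+1 n).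
  elim: n k => //= n IH k; rewrite -IH (_ : _ + step 0 = (k.+1%:Z, 0)) //.
  by apply/eqP; rewrite eq_Z2 /=; lia.
have turnsE : turns (nseq n 0) = nseq n.-1 0.
  case: n {posE} => //= n; rewrite /turns /=; elim: n => //= n ->.
  by rewrite subrr.
have no_turn (t : 'Z_4) : t != 0 -> ~~ infix [:: t; t] (turns (nseq n 0)).
  move=> t0; rewrite turnsE; apply/negP => /mem_infix /(_ t).
  by rewrite inE eqxx mem_nseq (negPf t0) andbF => /(_ isT).
apply/and4P; split; [| |exact: no_turn|exact: no_turn].
- rewrite /positions -[0]/((0%N%:Z, 0) : Z2) posE.
  elim: n 0%N {posE turnsE no_turn} => //= n IH k; rewrite IH andbT.
  by rewrite /manhattan /= xpair_eqE eqxx andbT; apply/orP; left; lia.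
- rewrite /positions -[0]/((0%N%:Z, 0) : Z2) posE.
  rewrite -[_ :: _]/(map (fun i : nat => (i%:Z, 0) : Z2) (iota 0 n.+1)).
  by rewrite map_inj_uniq ?iota_uniq // => i j /eqP; rewrite xpair_eqE eqxx andbT => /eqP[].
Qed.

(** * Growth estimates and Fekete's lemma *)

Lemma bernoulli (R : realDomainType) (h : R) n : 0 <= h ->
  1 + n%:R * h <= (1 + h) ^+ n.
Proof.
move=> h0; elim: n => [|n IH]; first by rewrite mul0r addr0 expr0.
rewrite exprS (@le_trans _ _ ((1 + h) * (1 + n%:R * h))) //; last first.
  by rewrite ler_pM2l // ltr_pwDl.
have nh : 0 <= n%:R * h * h by rewrite !mulr_ge0.
rewrite mulrDr mulr1 !mulrDl !mul1r -addn1 natrD mulrDl mul1r.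
have -> : h * (n%:R * h) = n%:R * h * h by ring.
lra.
Qed.

Lemma exp_ge (R : archiRealFieldType) (a K : R) : 1 < a ->
  exists N, forall n, (N <= n)%N -> K <= a ^+ n.
Proof.
move=> a1; have h0 : 0 < a - 1 by rewrite subr_gt0.
have [N NP] : exists N : nat, K / (a - 1) <= N%:R.
  exists (Num.Def.archi_bound `|K / (a - 1)|); apply: le_trans (ler_norm _) _.
  by rewrite ltW // archi_boundP.
have a1E : 1 + (a - 1) = a by rewrite addrC subrK.
exists N => n Nn; have := bernoulli n (ltW h0); rewrite a1E; apply: le_trans.
rewrite -[X in X <= _](divfK (lt0r_neq0 h0)) -[X in X <= _]add0r lerD //.
by rewrite ler_pM2r // (le_trans NP) // ler_nat.
Qed.

Section Fekete.
Variables (R : realType) (c : nat -> nat).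
Hypothesis c_gt0 : forall n, (0 < c n)%N.
Hypothesis c_submul : forall m n, (c (m + n) <= c m * c n)%N.

Let x (n : nat) : R := (c n)%:R `^ n%:R^-1.

Lemma root_expK n : (0 < n)%N -> x n ^+ n = (c n)%:R.
Proof.
move=> n0; rewrite -powR_mulrn ?powR_ge0 // /x -powRrM mulVf ?powRr1 //.
by rewrite pnatr_eq0 -lt0n.
Qed.

Lemma root_ge1 n : 1 <= x n.
Proof.
rewrite -(powRr0 (c n)%:R) /x; apply: ler_powR; first by rewrite ler1n.
by rewrite invr_ge0.
Qed.

Lemma submul_pow k q r : (c (q * k + r) <= c k ^ q * c r)%N.
Proof.
elim: q => [|q IH]; first by rewrite mul0n expn0 mul1n.
rewrite mulSn -addnA (leq_trans (c_submul _ _)) // expnS -mulnA.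
by rewrite leq_mul2l IH orbT.
Qed.

(** Division of [n] by [k] gives [c n <= x k ^+ n * K], where [K] dominates all remainders; the
    powers of [y / x k > 1] eventually exceed [K]. *)
Lemma submul_le k y : (0 < k)%N -> x k < y ->
  exists N, forall n, (N <= n)%N -> (c n)%:R <= y ^+ n.
Proof.
move=> k0 ky; have xk0 : 0 < x k by apply: lt_le_trans (root_ge1 k).
pose K := (\sum_(r < k) c r)%N.
have [|N NP] := @exp_ge R (y / x k) K%:R; first by rewrite ltr_pdivlMr ?mul1r.
exists N => n /NP Kn; have rk := ltn_pmod n k0.
have cn : (c n <= c k ^ (n %/ k) * K)%N.
  rewrite {1}(divn_eq n k) (leq_trans (submul_pow _ _ _)) // leq_mul2l.
  by rewrite /K (bigD1 (Ordinal rk)) //= leq_addr orbT.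
apply: (@le_trans _ _ (x k ^+ n * K%:R)).
  apply: le_trans (_ : (c k ^ (n %/ k) * K)%:R <= _); first by rewrite ler_nat.
  rewrite natrM ler_wpM2r // natrX -root_expK // -exprM ler_weXn2l ?root_ge1 //.
  by rewrite mulnC leq_divM.
rewrite -ler_pdivlMl ?exprn_gt0 //; apply: le_trans Kn _.
by rewrite exprMn exprVn mulrC.
Qed.

Lemma fekete : exists2 L : R, 1 <= L & (x @ \oo --> L)%classic /\
  forall y, L < y -> exists N, forall n, (N <= n)%N -> (c n)%:R <= y ^+ n.
Proof.
(* Index 0 has to be excluded: [0^-1 = 0] gives [x 0 = 1], which would make the infimum 1. *)
pose E : set R := [set x n | n in [set n | (0 < n)%N]]%classic.
have E0 : (E !=set0)%classic by exists (x 1), 1%N.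
have Elb : lbound E 1 by move=> _ [n _ <-]; exact: root_ge1.
have Einf : has_inf E by split=> //; exists 1.
have above y : inf E < y -> exists N, forall n, (N <= n)%N -> (c n)%:R <= y ^+ n.
  move=> Ey; have [|_ [k k0 <-]] := @inf_adherent _ E (y - inf E) _ Einf.
    by rewrite subr_gt0.
  by rewrite addrC subrK; exact: submul_le.
exists (inf E); first exact: lb_le_inf.
split=> //; apply/cvgrPdist_le => e e0.
have [|N NP] := above (inf E + e); first by rewrite ltrDl.
near=> n; have n0 : (0 < n)%N by near: n; exists 1%N.
have Ln : inf E <= x n.
  by apply: ge_inf; [exists 1|exists n].
rewrite distrC ger0_norm ?subr_ge0 // lerBlDl.
have L0 : 0 <= inf E by apply: le_trans (lb_le_inf E0 Elb).
rewrite -(@ler_pXn2r _ n n0) ?nnegrE ?addr_ge0 ?powR_ge0 ?(ltW e0) //.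
by rewrite root_expK //; apply: NP; near: n; exists N.
Unshelve. all: by end_near. Qed.
End Fekete.

Lemma taxi_connective_constantP (R : realType) :
  1 <= taxi_connective_constant R /\
  forall y, taxi_connective_constant R < y ->
    exists N, forall n, (N <= n)%N -> (taxi_count n)%:R <= y ^+ n.
Proof.
have [L L1 [xL LP]] := @fekete R _ taxi_count_gt0 taxi_count_submul.
by rewrite /taxi_connective_constant (cvg_lim _ xL).
Qed.

Lemma linear_exp_bounded (R : archiRealFieldType) (t : R) : 0 < t < 1 ->
  exists2 B, 0 < B & forall k, k%:R * t ^+ k <= B.
Proof.
move=> /andP[t0 t1]; have h0 : 0 < t^-1 - 1 by rewrite subr_gt0 invf_gt1.
exists (t^-1 - 1)^-1; first by rewrite invr_gt0.
move=> k; rewrite -[X in _ <= X]mul1r ler_pdivlMr // mulrAC.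
rewrite -ler_pdivlMr ?exprn_gt0 // mul1r -exprVn.
have tE : 1 + (t^-1 - 1) = t^-1 by rewrite addrC subrK.
have := bernoulli k (ltW h0); rewrite tE.
by apply: le_trans; rewrite lerDr.
Qed.

Lemma geometric_tail (R : archiRealFieldType) (t B e : R) : 0 < t < 1 -> 0 < B ->
  0 < e -> exists N, forall p M, (N <= p)%N -> \sum_(p <= k < M) B * t ^+ k <= e.
Proof.
move=> /andP[t0 t1] B0 e0; have t10 : 0 < 1 - t by rewrite subr_gt0.
have [|N NP] := @exp_ge R t^-1 (B / (e * (1 - t))); first by rewrite invf_gt1.
exists N => p M Np.
have tele : \sum_(p <= k < M) B * t ^+ k <= B * t ^+ p / (1 - t).
  have [pM|Mp] := leqP p M; last first.
    by rewrite big_geq ?(ltnW Mp) // divr_ge0 ?mulr_ge0 ?exprn_ge0 // ltW.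
  rewrite ler_pdivlMr // mulr_suml.
  rewrite (_ : \sum_(p <= k < M) _ = B * t ^+ p - B * t ^+ M).
    by rewrite gerBl mulr_ge0 ?exprn_ge0 ?ltW.
  transitivity (- \sum_(p <= k < M) (B * t ^+ k.+1 - B * t ^+ k)); last first.
    by rewrite (telescope_sumr (fun k => B * t ^+ k)) // opprB.
  rewrite -sumrN.
  by apply: eq_bigr => k _; rewrite exprS; ring.
apply: le_trans tele _; rewrite ler_pdivrMr // -ler_pdivlMr ?exprn_gt0 //.
have := NP p Np; rewrite ler_pdivrMr ?mulr_gt0 // exprVn => H.
by rewrite [X in _ <= X]mulrC.
Qed.

Lemma contour_weight_tail (R : realType) (lambda : R) :
  taxi_connective_constant R ^+ 4 - 1 < lambda ->
  exists rho : R, [/\ 0 < rho, rho ^+ 4 = 1 + lambda &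
    forall e, 0 < e -> exists N, forall p M, (N <= p)%N ->
      \sum_(p <= k < M) ((k.+1 + k.+1).+1 ^ 2 * taxi_count k)%:R / rho ^+ k.+1 <= e].
Proof.
move=> hl; have [L1 LP] := taxi_connective_constantP R.
set L := taxi_connective_constant R in hl L1 LP.
have L0 : 0 < L by exact: lt_le_trans L1.
have l1 : 0 <= 1 + lambda by have := exprn_ge0 4 (ltW L0); lra.
pose rho : R := Num.sqrt (Num.sqrt (1 + lambda)).
have rho4 : rho ^+ 4 = 1 + lambda.
  by rewrite (exprM rho 2 2) !sqr_sqrtr // sqrtr_ge0.
have Lrho : L < rho.
  rewrite -(@ltr_pXn2r _ 4) ?nnegrE ?sqrtr_ge0 //; last exact: ltW.
  by rewrite rho4; lra.
have rho0 : 0 < rho by exact: lt_trans Lrho.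
exists rho; split=> // e e0.
pose y := (L + rho) / 2.
have [Ly yrho] : L < y /\ y < rho by rewrite /y; split; lra.
have y0 : 0 < y by exact: lt_trans Ly.
have [N1 N1P] := LP y Ly.
pose th := y / rho.
have th01 : 0 < th < 1 by rewrite divr_gt0 //= ltr_pdivrMr // mul1r.
(* So [(y / rho) ^+ k = s ^+ k * (t ^+ k) ^+ 2]: the first factor keeps the series geometric, the
   second absorbs the square of [2 k + 3]. *)
pose s := Num.sqrt th; pose t := Num.sqrt s.
have sqrt01 (z : R) : 0 < z < 1 -> 0 < Num.sqrt z < 1.
  by move=> /andP[z0 z1]; rewrite sqrtr_gt0 z0 /= -sqrtr1 ltr_sqrt.
have s01 : 0 < s < 1 by exact: sqrt01.
have t01 : 0 < t < 1 by exact: sqrt01.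
have sE : s ^+ 2 = th by rewrite sqr_sqrtr // ltW //; case/andP: th01.
have tE : t ^+ 2 = s by rewrite sqr_sqrtr // ltW //; case/andP: s01.
have [B B0 BP] := linear_exp_bounded t01.
pose D := (2 * B + 3) ^+ 2 / rho.
have D0 : 0 < D by rewrite divr_gt0 // exprn_gt0 //; lra.
have [N2 N2P] := geometric_tail s01 D0 e0.
exists (maxn N1 N2) => p M; rewrite geq_max => /andP[Np1 Np2].
apply: le_trans (N2P p M Np2); rewrite big_nat [X in _ <= X]big_nat.
apply: ler_sum => k /andP[pk _].
have [t0 /ltW t1] := andP t01.
have poly : ((k.+1 + k.+1).+1)%:R * t ^+ k <= 2 * B + 3.
  have -> : (k.+1 + k.+1).+1%:R = 2 * k%:R + 3 :> R.
    by rewrite -(addn1 (k.+1 + k.+1)) -(addn1 k) !natrD; ring.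
  rewrite mulrDl -mulrA lerD ?ler_pM2l //.
  by rewrite ler_piMr // exprn_ile1 // ltW.
rewrite natrM natrX [rho ^+ k.+1]exprS invfM mulrA.
apply: (@le_trans _ _ ((k.+1 + k.+1).+1%:R ^+ 2 * y ^+ k / rho / rho ^+ k)).
  rewrite ler_pM2r ?invr_gt0 ?exprn_gt0 // ler_pM2r ?invr_gt0 //.
  by rewrite ler_wpM2l ?exprn_ge0 // N1P // (leq_trans Np1).
have -> : (k.+1 + k.+1).+1%:R ^+ 2 * y ^+ k / rho / rho ^+ k =
    ((k.+1 + k.+1).+1%:R * t ^+ k) ^+ 2 / rho * s ^+ k.
  have t2 : (t ^+ k) ^+ 2 = s ^+ k by rewrite -exprM mulnC exprM tE.
  rewrite [(_ * t ^+ k) ^+ 2]exprMn t2.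
  have -> : y ^+ k = (s ^+ k * s ^+ k) * rho ^+ k.
    by rewrite -!exprMn -expr2 sE divfK // gt_eqF.
  by field; rewrite gt_eqF //= expf_neq0 // gt_eqF.
rewrite ler_pM2r; last by rewrite exprn_gt0 //; case/andP: s01.
rewrite ler_pM2r ?invr_gt0 // ler_pXn2r ?nnegrE //; last by lra.
by rewrite mulr_ge0 ?exprn_ge0 // ltW.
Qed.

(** * The finite-volume Gibbs measures *)

(** All that the specification in [L] sees of the outside. Its finitely many values index the sums
    replacing conditional expectations. *)
Definition admissible (L : {fset Z2}) (I : set Z2) : {fset {fset Z2}} :=
  [fset K in fpowerset L | `[< independent (overlay L K I) >]]%fset.

Lemma mem_admissible L I K :
  (K \in admissible L I) = (K `<=` L)%fset && `[< independent (overlay L K I) >].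
Proof. by rewrite !inE /= fpowersetE. Qed.

Definition inside (L J : {fset Z2}) : set (set Z2) :=
  [set I | I `&` [set` L] = [set` J]]%classic.

Definition local (D : set Z2) (E : set (set Z2)) : Prop :=
  forall I I', independent I -> independent I' ->
    (forall x, D x -> I x <-> I' x) -> E I -> E I'.

Lemma localI D E F : local D E -> local D F -> local D (E `&` F)%classic.
Proof.
move=> lE lF I I' iI iI' II' [EI FI].
by split; [exact: lE EI|exact: lF FI].
Qed.

Lemma local_sub D D' E : (D `<=` D')%classic -> local D E -> local D' E.
Proof. by move=> DD' lE I I' iI iI' II'; apply: lE => // x /DD'; exact: II'. Qed.

Lemma overlay_overlay (L K B M : {fset Z2}) (I : set Z2) (K' : {fset Z2}) :
  (L `<=` B)%fset -> (K `<=` L)%fset -> (M `<=` B `\` L)%fset ->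
  overlay L K' (overlay B (K `|` M)%fset I) = overlay B (K' `|` M)%fset I.
Proof.
move=> /fsubsetP LB /fsubsetP KL /fsubsetP MB; rewrite predeqE => x.
have ML : x \in M -> ~ x \in L by move=> /MB; rewrite in_fsetD => /andP[/negP].
rewrite /overlay /= !in_fsetU; split.
  case=> [xK|[[/orP[/KL//|xM]|[Ix xB]] xL]]; first by left; rewrite xK.
    by left; rewrite xM orbT.
  by right.
case=> [/orP[xK|xM]|[Ix xB]]; first by left.
  by right; split; [left; rewrite xM orbT|exact: ML].
by right; split; [right|move=> /LB].
Qed.

Section Volume.
Variables (R : realType) (lambda : R).
Hypothesis lambda_gt0 : 0 < lambda.

Definition spec_value (J : {fset Z2}) (V : {fset {fset Z2}}) : R :=
  (if J \in V then lambda ^+ #|` J| else 0) / \sum_(K <- V) lambda ^+ #|` K|.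

Lemma hc_specE L J I : (J `<=` L)%fset ->
  hc_spec lambda L J I = spec_value J (admissible L (val I)).
Proof.
move=> JL; rewrite /hc_spec /spec_value /hc_weight mem_admissible JL; congr (_ / _).
rewrite -big_mkcond /= -big_filter.
apply: perm_big; apply: uniq_perm; rewrite ?filter_uniq ?fset_uniq // => K.
by rewrite mem_filter mem_admissible fpowersetE andbC.
Qed.

Lemma spec_value_ge0 J V : 0 <= spec_value J V.
Proof.
have l0 n : 0 <= lambda ^+ n by rewrite exprn_ge0 // ltW.
by rewrite /spec_value divr_ge0 ?sumr_ge0 //; case: ifP.
Qed.

Lemma spec_valueK J V :
  spec_value J V * \sum_(K <- V) lambda ^+ #|` K| =
  if J \in V then lambda ^+ #|` J| else 0.
Proof.
rewrite /spec_value; case: ifP => JV; last by rewrite !mul0r.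
rewrite divfK // gt_eqF // (bigD1_seq J) ?fset_uniq //=.
rewrite ltr_pwDl ?exprn_gt0 ?sumr_ge0 // => K _.
by rewrite exprn_ge0 // ltW.
Qed.

(** For a fixed part [M] of the configuration in [B] outside [L], neither [admissible L] nor [E]
    depends on the admissible part in [L], and weights factorize. What remains for each [M] is
    [spec_valueK]. *)
Lemma hc_sum_dlr (L B J : {fset Z2}) (I : config) (E : set (set Z2)) :
  (L `<=` B)%fset -> (J `<=` L)%fset -> local (~` [set` L])%classic E ->
  hc_sum lambda B I (inside L J `&` E)%classic =
  \sum_(V <- fpowerset (fpowerset L)) spec_value J V *
    hc_sum lambda B I ([set X | admissible L X = V] `&` E)%classic.
Proof.
move=> LB JL lE; pose G (K M : {fset Z2}) := overlay B (K `|` M)%fset (val I).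
pose l (K : {fset Z2}) : R := lambda ^+ #|` K|.
have dLB : [disjoint L & B `\` L]%fset 
  by apply/eqP/fsetP => x; rewrite !inE; case: (x \in L); rewrite ?andbF.
have BE : B = (L `|` (B `\` L))%fset by rewrite fsetUDl fsetDv fsetD0 (fsetUidPr _ _ LB).
transitivity (\sum_(K <- fpowerset B) if `[< independent (overlay B K (val I)) >] &&
    `[< (inside L J `&` E)%classic (overlay B K (val I)) >] then l K else 0).
  by rewrite hc_sumE big_mkcond.
transitivity (\sum_(K <- fpowerset B) if `[< independent (overlay B K (val I)) >] &&
    `[< E (overlay B K (val I)) >]
    then l K * spec_value J (admissible L (overlay B K (val I))) else 0); last first.
  under [RHS]eq_bigr => V _ do rewrite hc_sumE big_mkcond mulr_sumr.
  rewrite [RHS]exchange_big /=; apply: eq_bigr => K _.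
  rewrite (bigD1_seq (admissible L (overlay B K (val I)))) ?fset_uniq //=; last first.
    by rewrite fpowersetE; apply/fsubsetP => x; rewrite mem_admissible fpowersetE => /andP[].
  rewrite [X in _ = _ + X]big1 ?addr0; last first.
    move=> V VK; case: ifP; rewrite ?mulr0 // => /andP[_ /asboolP[/= VE _]].
    by rewrite VE eqxx in VK.
  rewrite (_ : `[< ([set X | admissible L X = admissible L (overlay B K (val I))] `&` E)%classic
    (overlay B K (val I)) >] = `[< E (overlay B K (val I)) >]).
    by case: ifP; rewrite ?mulr0 // mulrC.
  by apply/asboolP/asboolP => [[]|EK] //; split.
rewrite BE (big_fpowersetU _ dLB) [RHS](big_fpowersetU _ dLB) -BE.
rewrite exchange_big [RHS]exchange_big /=.
rewrite big_seq [RHS]big_seq; apply: eq_bigr => M; rewrite fpowersetE => MB.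
have card_KM K : (K `<=` L)%fset -> l (K `|` M)%fset = l K * l M.
  move=> KL; rewrite /l -exprD cardfsU (_ : K `&` M = fset0)%fset ?cardfs0 ?subn0 //.
  apply/eqP; rewrite -fsubset0 -(eqP dLB); exact: fsetISS.
pose adm := admissible L (G fset0 M).
have admE K : (K `<=` L)%fset -> admissible L (G K M) = adm.
  move=> KL; apply/fsetP => K'; rewrite !mem_admissible.
  by rewrite /G !(overlay_overlay _ _ LB) ?fsub0set.
have mem_adm K : (K `<=` L)%fset -> (K \in adm) = `[< independent (G K M) >].
  by move=> KL; rewrite mem_admissible KL /G (overlay_overlay _ _ LB) ?fsub0set.
have GL K x : (K `<=` L)%fset -> x \in L -> G K M x <-> x \in K.
  move=> KL xL; rewrite /G /overlay /= in_fsetU; split=> [[/orP[//|]|[_ []]]|xK].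
  - by move=> /(fsubsetP MB); rewrite in_fsetD xL.
  - exact: (fsubsetP LB).
  - by left; rewrite xK.
have EK K K' : K \in adm -> K' \in adm -> E (G K M) -> E (G K' M).
  move=> Ka Ka'; have /andP[KL _] : (K `<=` L)%fset && true.
    by move: Ka; rewrite mem_admissible => /andP[->].
  have /andP[KL' _] : (K' `<=` L)%fset && true.
    by move: Ka'; rewrite mem_admissible => /andP[->].
  rewrite mem_adm // in Ka; rewrite mem_adm // in Ka'.
  apply: (lE _ _ (asboolW Ka) (asboolW Ka')) => x /negP xL.
  have xK : x \in K = false by apply: contraNF xL; exact: (fsubsetP KL).
  have xK' : x \in K' = false by apply: contraNF xL; exact: (fsubsetP KL').
  by rewrite /G /overlay /= !in_fsetU xK xK'.
have insideE K : (K `<=` L)%fset -> inside L J (G K M) <-> K = J.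
  move=> KL; rewrite /inside /= predeqE; split=> [KJ|<- x /=].
    apply/fsetP => x; have [xL|xL] := boolP (x \in L).
      apply/idP/idP => [xK|xJ].
        by apply/KJ; split=> //; apply/(GL K x KL xL).
      by apply/(GL K x KL xL); have /KJ[] : [set` J]%classic x by [].
    apply/idP/idP => [/(fsubsetP KL)|/(fsubsetP JL)]; by rewrite (negPf xL).
  by split=> [[/(GL K x KL) + xL]|xK]; [exact|have xL := fsubsetP KL x xK; split=> //; exact/(GL K x KL)].
transitivity (if (J \in adm) && `[< E (G J M) >] then l J * l M else 0).
  rewrite (bigD1_seq J) ?fset_uniq ?fpowersetE //= [X in _ + X]big_seq_cond.
  rewrite [X in _ + X]big1 ?addr0 => [|K /andP[]]; last first.
    rewrite fpowersetE => KL KJ; case: ifP => // /andP[_ /asboolP[/(insideE _ KL) E0 _]].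
    by rewrite E0 eqxx in KJ.
  rewrite mem_adm // card_KM //; congr (if _ && _ then _ else _).
  by apply/asboolP/asboolP => [[]|EJ] //; split=> //; apply/insideE.
transitivity (\sum_(K <- fpowerset L | K \in adm)
    if `[< E (G K M) >] then l K * l M * spec_value J adm else 0); last first.
  rewrite big_mkcond big_seq [RHS]big_seq; apply: eq_bigr => K; rewrite fpowersetE => KL.
  by rewrite mem_adm // -/(G K M) admE // card_KM //; do 2 case: `[< _ >].
have admP : perm_eq [seq K <- fpowerset L | K \in adm] adm.
  apply: uniq_perm; rewrite ?filter_uniq ?fset_uniq // => K.
  by rewrite mem_filter fpowersetE andb_idr // mem_admissible => /andP[].
rewrite -big_filter (perm_big _ admP) /=.
have := spec_valueK J adm; case: ifP => /= [Ja Z|Ja _]; last first.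
  rewrite big1 // => K _; rewrite /spec_value Ja mul0r mulr0; by case: ifP.
rewrite (_ : \sum_(K <- adm) _ = \sum_(K <- adm) (if `[< E (G J M) >] then
    l K * l M * spec_value J adm else 0)); last first.
  rewrite big_seq [RHS]big_seq; apply: eq_bigr => K Ka.
  rewrite (_ : `[< E (G K M) >] = `[< E (G J M) >]) //.
  by apply/asboolP/asboolP; exact: EK.
case: ifP => _; last by rewrite big1.
have Z' : (\sum_(K <- adm) l K) * spec_value J adm = l J by rewrite mulrC.
by rewrite -!mulr_suml [RHS]mulrAC Z'.
Qed.

End Volume.

(** The escape ends one step outside [box m], and the phase of a site involves its neighbors: hence
    [m.+2]. *)
Lemma escape_local q k m :
  local [set` box m.+2]%classic (escape q k m).
Proof.
move=> I I' _ _ II0 [v [w [d [vk vw ym Sy]]]].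
have II' x : x \in box m.+2 -> I x -> I' x by move=> /II0[].
have phaseE x : in_box m.+1 x -> phase_set q I x -> phase_set q I' x.
  move=> xm; rewrite /phase_set; case: ifP => _.
    by apply: II'; rewrite in_boxE; move: xm; rewrite /in_box; lia.
  move=> [e Ie]; exists e; apply: II' Ie; rewrite in_boxE.
  move: xm; rewrite /in_box; case: (x) => a b /=; have := stepP e.
  by case: (step e) => s t /=; lia.
have mS x : in_box m x -> in_box m.+1 x by rewrite /in_box; lia.
exists v, w, d; split=> //.
  by apply: linked_sub vw => x [Sx xm]; split=> //; apply: phaseE Sx; exact: mS.
apply: phaseE Sy; have [_] := linked_right vw; rewrite /in_box.
case: (w) => a b /=; have := stepP d; case: (step d) => s t /=; lia.
Qed.

(** [D] is the outer vertex boundary of [L]: only occupied sites adjacent to [L] constrain what is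
    inside. *)
Lemma admissible_local (L : {fset Z2}) : exists2 D : {fset Z2},
  ([set` D] `<=` ~` [set` L])%classic &
  forall V, local [set` D]%classic [set I | admissible L I = V]%classic.
Proof.
pose D := ([fset (x.1 + step x.2)%R | x in [seq (x, d) | x <- enum_fset L, d <- enum 'Z_4]] `\` L)%fset.
have DP x d : x \in L -> x + step d \notin L -> x + step d \in D.
  move=> xL yL; rewrite in_fsetD yL /=; apply/imfsetP; exists (x, d) => //=.
  by apply/allpairsP; exists (x, d); rewrite mem_enum.
exists D => [x /=|V I I' iI iI' II' /= <-].
  by rewrite in_fsetD => /andP[/negP].
have half (X Y : set Z2) K : independent X -> independent Y ->
    (forall x, [set` D]%classic x -> X x <-> Y x) ->
    (K `<=` L)%fset -> independent (overlay L K X) -> independent (overlay L K Y).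
  move=> iX iY XY KL iKX.
  have cross u v : u \in K -> Y v -> v \notin L -> ~~ lattice_adj u v.
    move=> uK Yv vL; apply/negP => uv; have /lattice_adjP[d vE] := uv.
    have vD : v \in D by rewrite vE; apply: DP; [exact: (fsubsetP KL)|rewrite -vE].
    suff : ~~ lattice_adj u v by rewrite uv.
    apply: iKX; [by left|right; split; last exact/negP].
    exact: (proj2 (XY v vD)).
  move=> u v [uK|[Yu /negP uL]] [vK|[Yv /negP vL]].
  - by apply: iKX; left.
  - exact: cross.
  - by rewrite lattice_adjC; exact: cross.
  - exact: iY.
apply/fsetP => K; rewrite !mem_admissible; have [KL|//] := boolP (K `<=` L)%fset.
apply/asboolP/asboolP; apply: half => // x xD; by apply: iff_sym; exact: II'.
Qed.

Lemma inside_local (L J : {fset Z2}) : local [set` L]%classic (inside L J).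
Proof.
move=> I I' _ _ II' IJ; rewrite /inside /= -IJ predeqE => x.
by split=> -[Ix xL]; split=> //; [apply/(II' x xL)|apply/(II' x xL)].
Qed.

Section State.
Variables (R : realType) (lambda : R).
Hypothesis lambda_gt0 : 0 < lambda.

Definition box_prob (q : bool) (n : nat) (E : set (set Z2)) : R :=
  hc_sum lambda (box n) (boundary q) E / hc_sum lambda (box n) (boundary q) setT.

Lemma hc_sum_le L I (E F : set (set Z2)) :
  (forall J, (J `<=` L)%fset -> independent (overlay L J (val I)) ->
     E (overlay L J (val I)) -> F (overlay L J (val I))) ->
  hc_sum lambda L I E <= hc_sum lambda L I F.
Proof.
move=> EF; have := @hc_sum_union _ _ lambda_gt0 _ [:: tt] L I E (fun=> F).
rewrite big_seq1; apply=> J JL iJ EJ; exists tt; rewrite ?inE //; exact: EF.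
Qed.

Lemma hc_sum_split L I (E F : set (set Z2)) :
  hc_sum lambda L I E =
  hc_sum lambda L I (E `&` F)%classic + hc_sum lambda L I (E `&` ~` F)%classic.
Proof.
rewrite /hc_sum (bigID (fun J => `[< F (overlay L J (val I)) >])) /=.
by congr (_ + _); apply: eq_bigl => J; rewrite asbool_and // asbool_neg.
Qed.

Lemma box_prob_ge0 q n E : 0 <= box_prob q n E.
Proof.
rewrite divr_ge0 //; last by rewrite ltW // hc_sum_gt0.
by apply: sumr_ge0 => J _; exact: hc_weight_ge0.
Qed.

Lemma box_probT q n : box_prob q n setT = 1.
Proof. by rewrite /box_prob divff // gt_eqF // hc_sum_gt0. Qed.

Lemma box_prob_split q n E F :
  box_prob q n E = box_prob q n (E `&` F)%classic + box_prob q n (E `&` ~` F)%classic.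
Proof. by rewrite /box_prob -mulrDl -hc_sum_split. Qed.

Lemma box_prob_le q n (E F : set (set Z2)) :
  (forall I, independent I -> E I -> F I) -> box_prob q n E <= box_prob q n F.
Proof.
move=> EF; rewrite ler_pM2r ?invr_gt0 ?hc_sum_gt0 //; apply: hc_sum_le => J _.
exact: EF.
Qed.

Lemma box_prob_dlr q n (L J : {fset Z2}) (E : set (set Z2)) :
  (L `<=` box n)%fset -> (J `<=` L)%fset -> local (~` [set` L])%classic E ->
  box_prob q n (inside L J `&` E)%classic =
  \sum_(V <- fpowerset (fpowerset L)) spec_value lambda J V *
    box_prob q n ([set X | admissible L X = V] `&` E)%classic.
Proof.
move=> LB JL lE; rewrite /box_prob (hc_sum_dlr _ _ LB) // mulr_suml.
by apply: eq_bigr => V _; rewrite mulrA.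
Qed.

Lemma box_prob_escape : taxi_connective_constant R ^+ 4 - 1 < lambda ->
  exists k m, forall q n, (m <= n)%N ->
    box_prob q n (escape (~~ q) k m) <= 1 / 3 /\
    box_prob q n (~` escape q k m)%classic <= 1 / 3.
Proof.
move=> /contour_weight_tail[rho [rho0 rho4 tail]].
have [|N1 N1P] := tail (1 / 3); first by lra.
(* [N1] controls the contours around the origin, which gives [k]. Then [N2] controls those around
   each site of [box k], with a budget divided by the number of these sites. *)
pose k := (N1 + N1 + 12)%N; pose e : R := (1 / 3) / #|` box k|%:R.
have box0 : (0 < #|` box k|)%N.
  by rewrite cardfs_gt0; apply/fset0Pn; exists 0; rewrite in_boxE.
have [|N2 N2P] := tail e; first by rewrite divr_gt0 ?ltr0n //; lra.
pose m := (k + N2 + N2 + 12)%N; exists k, m => q n mn.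
have overlay_bd J x : (J `<=` box n)%fset -> ~~ in_box n x ->
    overlay (box n) J (val (boundary q)) x <-> parity x = q.
  move=> JB xn; rewrite /overlay /=; split=> [[/(fsubsetP JB)|[//]]|xq].
    by rewrite in_boxE (negPf xn).
  by right; split=> //; rewrite in_boxE; exact/negP.
have bound v p (e' : R) : (forall M, \sum_(p <= i < M) contour_weight rho i <= e') ->
    hc_sum lambda (box n) (boundary q) (contour_around n q v p) <=
    e' * hc_sum lambda (box n) (boundary q) setT.
  move=> He; have [M HM] :=
    contour_around_sum lambda_gt0 rho0 rho4 n q v p (boundary q).
  by apply: le_trans HM _; rewrite ler_pM2r ?hc_sum_gt0.
split; rewrite ler_pdivrMr ?hc_sum_gt0 //.
  apply: (@le_trans _ _ (\sum_(v <- enum_fset (box k))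
      hc_sum lambda (box n) (boundary q) (contour_around n q v N2))).
    apply: hc_sum_union => // J JB iJ eJ.
    have [|v vk cv] := @escape_contour q n _ iJ (fun x => overlay_bd J x JB) k m N2 _ eJ.
      exact: leqnn.
    by exists v; rewrite ?in_boxE.
  apply: (@le_trans _ _ (\sum_(v <- enum_fset (box k))
      e * hc_sum lambda (box n) (boundary q) setT)).
    by apply: ler_sum => v _; apply: bound => M; exact: N2P.
  rewrite big_const_seq count_predT iter_addr_0 -[X in X <= _]mulr_natl mulrA /e.
  by rewrite mulrCA divff ?mulr1 // pnatr_eq0 -lt0n.
apply: le_trans (bound 0 N1 (1 / 3) _); last by move=> M; exact: N1P.
apply: hc_sum_le => J JB iJ neJ.
apply: (@no_escape_contour q n _ iJ (fun x => overlay_bd J x JB) k m N1 _ _ mn neJ).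
  exact: leqnn.
by rewrite /m /k; clear; lia.
Qed.
End State.

(** * Infinite-volume limits *)

Local Open Scope classical_set_scope.
Local Open Scope ring_scope.

Lemma ultra_bounded_cvg (R : realType) (U : set_system nat) (f : nat -> R) :
  UltraFilter U -> (forall n, 0 <= f n <= 1) -> cvg (f n @[n --> U]).
Proof.
move=> UU f01; have PU : ProperFilter U by exact: ultra_proper.
have [|l [_ cl]] := @segment_compact R 0 1 (f n @[n --> U]) (fmap_proper_filter _ PU).
  by apply: (@filterE _ U) => n /=; rewrite in_itv; exact: f01.
apply/cvg_ex; exists l => N Nl; rewrite /fmap /=.
have [//|UN] := in_ultra_setVsetC (f @^-1` N) UU.
have [x []] : (~` N `&` N) !=set0 by apply: cl => //; exact: UN.
by [].
Qed.

Lemma cvg_sum_seq (R : realType) (T I : Type) (U : set_system T) (s : seq I)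
    (f : I -> T -> R) (l : I -> R) : ProperFilter U ->
  (forall i, f i x @[x --> U] --> l i) ->
  \sum_(i <- s) f i x @[x --> U] --> \sum_(i <- s) l i.
Proof.
move=> PU fl; elim: s => [|i s IH].
  rewrite big_nil (_ : (fun x => _) = fun=> 0); first exact: cvg_cst.
  by apply/funext => x; rewrite big_nil.
rewrite big_cons (_ : (fun x => _) = fun x => f i x + \sum_(i <- s) f i x).
  exact: cvgD.
by apply/funext => x; rewrite big_cons.
Qed.

(* Comparing events on independent sets only makes [p] carried by them. *)
Record finitely_additive (R : realType) (p : set (set Z2) -> R) : Prop := {
  fadd_ge0 : forall E, 0 <= p E;
  fadd_T : p setT = 1;
  fadd_split : forall E F, p E = p (E `&` F) + p (E `&` ~` F);
  fadd_le : forall E F : set (set Z2),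
    (forall I, independent I -> E I -> F I) -> p E <= p F }.

(** Along an ultrafilter finer than the one at infinity the box probabilities of all events converge
    at once, so finite additivity and the finite Gibbs identities pass to the limit. *)
Lemma limit_state (R : realType) (lambda : R) (q : bool) : 0 < lambda ->
  exists2 p, @finitely_additive R p &
  (forall (L J : {fset Z2}) E, (J `<=` L)%fset -> local (~` [set` L]) E ->
    p (inside L J `&` E) = \sum_(V <- fpowerset (fpowerset L))
      spec_value lambda J V * p ([set X | admissible L X = V] `&` E)) /\
  (forall E m c, (forall n, (m <= n)%N -> box_prob lambda q n E <= c) -> p E <= c).
Proof.
move=> l0; have [U [UU infU]] := @ultraFilterLemma _ (\oo : set_system nat) _.
have PU : ProperFilter U by exact: ultra_proper.
pose mu n E := box_prob lambda q n E.
have mu_le1 n E : mu n E <= 1.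
  by rewrite -(box_probT l0 q n); exact: box_prob_le.
have cmu E : cvg (mu n E @[n --> U]).
  apply: ultra_bounded_cvg => n; rewrite mu_le1 andbT; exact: box_prob_ge0.
have near_inf (P : nat -> Prop) m : (forall n, (m <= n)%N -> P n) -> \forall n \near U, P n.
  by move=> mP; apply: infU; exists m.
pose p E : R := lim (mu n E @[n --> U]).
exists p; first split.
- move=> E; apply: limr_ge; first exact: cmu.
  by apply: (near_inf _ 0%N) => n _; exact: box_prob_ge0.
- rewrite /p (_ : (fun n => mu n setT) = fun=> 1) ?lim_cst //.
  by apply/funext => n; exact: box_probT.
- move=> E F; rewrite /p -limD //.
  by congr (lim _); congr (_ @ U); apply/funext => n; exact: box_prob_split.
- move=> E F EF; apply: ler_lim => //.
  by apply: (near_inf _ 0%N) => n _; exact: box_prob_le.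
split=> [L J E JL lE|E m c mc]; last first.
  by apply: limr_le => //; exact: (near_inf _ m).
have [m Lm] : exists m, (L `<=` box m)%fset.
  exists (\max_(x <- enum_fset L) maxn `|x.1| `|x.2|)%N.
  apply/fsubsetP => x xL; rewrite in_boxE /in_box.
  have := @leq_bigmax_seq _ (enum_fset L) xpredT (fun x => maxn `|x.1| `|x.2|) x xL isT.
  by rewrite geq_max.
have box_mono n : (m <= n)%N -> (L `<=` box n)%fset.
  move=> mn; apply: fsubset_trans Lm _; apply/fsubsetP => x; rewrite !in_boxE /in_box.
  lia.
pose rhs n := \sum_(V <- fpowerset (fpowerset L)) spec_value lambda J V *
      mu n ([set X | admissible L X = V] `&` E).
have crhs : rhs n @[n --> U] --> \sum_(V <- fpowerset (fpowerset L))
      spec_value lambda J V * p ([set X | admissible L X = V] `&` E).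
  by apply: cvg_sum_seq => V; apply: cvgMr; exact: cmu.
rewrite -(cvg_lim _ crhs) //; apply/esym/cvg_lim => //.
apply: (cvg_trans _ (cmu (inside L J `&` E))); apply: near_eq_cvg.
apply: (near_inf _ m) => n mn; rewrite /rhs /mu box_prob_dlr //; exact: box_mono.
Qed.

(** * From finitely additive states to probability measures *)

Definition config_event (E : set (set Z2)) : set config := [set I | E (val I)].

Lemma config_ind (I : config) : independent (val I).
Proof. by have := valP I; rewrite inE. Qed.

(* The event that the word [r], read backwards, lists the occupation of the
   sites [st 0], ..., [st (size r).-1]. *)
Fixpoint word_event (st : nat -> Z2) (r : seq bool) : set (set Z2) :=
  if r is b :: r' then word_event st r' `&` [set I | `[< I (st (size r')) >] = b]
  else setT.

Lemma word_event_split st r (E : set (set Z2)) :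
  E `&` word_event st r =
  (E `&` word_event st (true :: r)) `|` (E `&` word_event st (false :: r)).
Proof.
rewrite predeqE => I /=; split; last by case=> -[EI [wI _]].
by move=> [EI wI]; case: (boolP `[< I (st (size r)) >]) => h; [left|right].
Qed.

Lemma word_event_agree st r I I' : word_event st r I -> word_event st r I' ->
  forall i, (i < size r)%N -> I (st i) <-> I' (st i).
Proof.
elim: r => //= b r IH [wI bI] [wI' bI'] i; rewrite ltnS leq_eqVlt.
case/predU1P => [->|]; last exact: IH.
have h : `[< I (st (size r)) >] = `[< I' (st (size r)) >] by rewrite bI bI'.
by split=> /asboolP; [rewrite h|rewrite -h] => /asboolP.
Qed.

Lemma word_event_local st k r (E : set (set Z2)) : (k <= size r)%N ->
  local [set st i | i in [set i | (i < k)%N]] E ->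
  (forall I, independent I -> ~ (E `&` word_event st r) I) \/
  (forall I, independent I -> word_event st r I -> E I).
Proof.
move=> kr lE; have [[I [iI [EI wI]]]|none] :=
  pselect (exists I, independent I /\ (E `&` word_event st r) I); last first.
  by left => I iI EI; apply: none; exists I.
right => I' iI' wI'; apply: lE EI => // _ [i /= ik <-].
by apply: (word_event_agree wI wI'); exact: leq_trans kr.
Qed.

Lemma sigma_algebra_setC (T : Type) (G : set (set T)) A :
  <<s G >> A -> <<s G >> (~` A).
Proof. by move=> GA; rewrite -setTD; exact: sigma_algebraCD. Qed.

Lemma sigma_algebra_setU (T : Type) (G : set (set T)) A B :
  <<s G >> A -> <<s G >> B -> <<s G >> (A `|` B).
Proof.
move=> GA GB; rewrite -bigcup2E; apply: sigma_algebra_bigcup => -[|[|i]] //=.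
exact: sigma_algebra0.
Qed.

Lemma sigma_algebra_setI (T : Type) (G : set (set T)) A B :
  <<s G >> A -> <<s G >> B -> <<s G >> (A `&` B).
Proof.
move=> GA GB; rewrite -[A `&` B]setCK setCI; apply: sigma_algebra_setC.
by apply: sigma_algebra_setU; exact: sigma_algebra_setC.
Qed.

Lemma word_event_measurable st k r :
  (size r <= k)%N ->
  <<s occupied_in [set st i | i in [set i | (i < k)%N]] >>
    (config_event (word_event st r)).
Proof.
elim: r => [_|b r IH rk] /=.
  rewrite (_ : config_event setT = ~` set0); last by rewrite setC0.
  by apply: sigma_algebra_setC; exact: sigma_algebra0.
have occ : <<s occupied_in [set st i | i in [set i | (i < k)%N]] >>
    (occupied (st (size r))).
  by apply: sub_sigma_algebra; exists (st (size r)) => //; exists (size r).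
rewrite (_ : config_event _ = config_event (word_event st r) `&`
  (if b then occupied (st (size r)) else ~` occupied (st (size r)))).
  apply: sigma_algebra_setI; first by apply: IH; exact: ltnW.
  by case: (b) => //; exact: sigma_algebra_setC.
rewrite predeqE => I; rewrite /config_event /occupied /=; split=> -[wI bI]; split=> //.
  by case: b bI {IH rk} => /asboolP.
by case: b bI {IH rk} => /= bI; [apply/asboolP|apply/asboolPn].
Qed.

(** Backward induction on the word, [j] being the number of bits not yet fixed. Once all [k] bits
    are fixed, a local event contains the word event or misses it. *)
Lemma local_word_measurable st k j r (E : set (set Z2)) : (size r + j)%N = k ->
  local [set st i | i in [set i | (i < k)%N]] E ->
  <<s occupied_in [set st i | i in [set i | (i < k)%N]] >>
    (config_event (E `&` word_event st r)).
Proof.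
elim: j r => [|j IH] r; last first.
  rewrite addnS -addSn => rk lE.
  rewrite (_ : config_event _ = config_event (E `&` word_event st (true :: r)) `|`
    config_event (E `&` word_event st (false :: r))).
    by apply: sigma_algebra_setU; apply: IH.
  by rewrite word_event_split.
rewrite addn0 => rk lE; have [|none|all] := @word_event_local st k r E _ lE.
- by rewrite rk.
- rewrite (_ : config_event _ = set0); first exact: sigma_algebra0.
  by rewrite -subset0 => I /= /none; apply; exact: config_ind.
- rewrite (_ : config_event _ = config_event (word_event st r)).
    by apply: word_event_measurable; rewrite rk.
  rewrite predeqE => I; rewrite /config_event /=; split=> [[]//|wI]; split=> //.
  by apply: all => //; exact: config_ind.
Qed.

Lemma local_measurable (D : {fset Z2}) (E : set (set Z2)) :
  local [set` D] E -> <<s occupied_in [set` D] >> (config_event E).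
Proof.
move=> lE; pose st i := nth 0 (enum_fset D) i.
have DE : [set` D] = [set st i | i in [set i | (i < size (enum_fset D))%N]].
  rewrite predeqE => x; split=> [/= xD|[i /= iD <-]]; last exact: mem_nth.
  by exists (index x (enum_fset D)); rewrite /= ?index_mem // /st nth_index.
move: lE; rewrite DE => lE.
have := @local_word_measurable st _ (size (enum_fset D)) [::] E (add0n _) lE.
by rewrite /= setIT.
Qed.

Section Additive.
Variables (R : realType) (p : set (set Z2) -> R).
Hypothesis pP : finitely_additive p.

Lemma fadd_eq (E F : set (set Z2)) :
  (forall I, independent I -> E I <-> F I) -> p E = p F.
Proof. by move=> EF; apply/le_anti/andP; split; apply: (fadd_le pP) => I /EF[]. Qed.

Lemma fadd0 (E : set (set Z2)) : (forall I, independent I -> ~ E I) -> p E = 0.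
Proof.
move=> nE; rewrite (_ : p E = p set0); last by apply: fadd_eq => I /nE.
by have := fadd_split pP setT set0; rewrite setI0 setC0 setIT; lra.
Qed.

Definition site (k : nat) : Z2 := odflt (0 : Z2) (choice.unpickle k).

Lemma pickle_site (v : Z2) : site (choice.pickle v) = v.
Proof. by rewrite /site choice.pickleK. Qed.

Definition word_prob (r : seq bool) : R := p (word_event site r).

Lemma word_prob_ge0 r : 0 <= word_prob r. Proof. exact: fadd_ge0. Qed.

Lemma word_prob_split r E :
  p (E `&` word_event site r) = p (E `&` word_event site (true :: r)) +
                                p (E `&` word_event site (false :: r)).
Proof.
rewrite (fadd_split pP _ [set I | `[< I (site (size r)) >] = true]); congr (p _ + p _).
  by rewrite /= setIA.
rewrite /= setIA; congr (_ `&` _); rewrite predeqE => I /=.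
by case: `[< _ >]; split.
Qed.

Lemma word_probE r : word_prob r = word_prob (true :: r) + word_prob (false :: r).
Proof. by have := word_prob_split r setT; rewrite !setTI. Qed.

(* The intervals [word_left r, word_left r + word_prob r[ of the words of a
   given length partition [0, 1[ in lexicographic order. *)
Fixpoint word_left (r : seq bool) : R :=
  if r is b :: r' then word_left r' + (if b then 0 else word_prob (true :: r')) else 0.

(** Successive subdivision: a uniform [u] reads each word with the probability prescribed by [p]. *)
Fixpoint sample_word (u : R) (k : nat) : seq bool :=
  if k is k'.+1 then
    let r := sample_word u k' in (u < word_left r + word_prob (true :: r)) :: r
  else [::].

Definition sample_bit (u : R) (k : nat) : bool := head false (sample_word u k.+1).

Lemma size_sample_word u k : size (sample_word u k) = k.
Proof. by elim: k => //= k ->. Qed.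

Lemma sample_wordP u r : 0 <= u < 1 -> (sample_word u (size r) == r) =
  (word_left r <= u < word_left r + word_prob r).
Proof.
move=> u01; elim: r => [|b r IH] /=.
  by rewrite add0r /word_prob /= (fadd_T pP).
rewrite eqseq_cons; have [sr|nsr] /= := eqVneq (sample_word u (size r)) r; last first.
  rewrite andbF; apply/esym/negbTE; rewrite (negPf nsr) in IH.
  apply: contraFN (esym IH) => /andP[].
  have := word_probE r; have := word_prob_ge0 (true :: r); have := word_prob_ge0 (false :: r).
  by case: b; lra.
rewrite sr andbT; rewrite sr eqxx in IH; have /esym/andP[l1 l2] := IH.
have := word_probE r; case: b => wE.
  by rewrite addr0 l1 /= eqb_id.
rewrite -addrA -wE l2 andbT eqbF_neg -leNgt //.
Qed.

Lemma sample_word_event u k I : word_event site (sample_word u k) I ->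
  forall i, (i < k)%N -> `[< I (site i) >] = sample_bit u i.
Proof.
elim: k => // k IH wI i; rewrite ltnS leq_eqVlt; have [wI' bI] := wI.
case/predU1P => [->|]; last exact: IH.
by move: bI; rewrite size_sample_word.
Qed.

Definition sample_set (u : R) : set Z2 := [set v | sample_bit u (choice.pickle v)].

(** The word intervals are half-open, so a word of probability zero has an empty interval and is
    read from no [u]. Two adjacent occupied sites would produce such a word. *)
Lemma sample_set_independent u : 0 <= u < 1 -> sample_set u \in independent.
Proof.
move=> u01; rewrite inE => v w vu wu; apply/negP => vw.
pose k := (maxn (choice.pickle v) (choice.pickle w)).+1.
have := sample_wordP (sample_word u k) u01; rewrite size_sample_word eqxx.
move=> /esym/andP[l1 l2]; have : 0 < word_prob (sample_word u k) by lra.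
rewrite /word_prob fadd0 ?ltxx // => I iI /sample_word_event kI.
have : ~~ lattice_adj v w.
  apply: iI; apply/asboolP; rewrite -[X in I X]pickle_site kI //;
    by rewrite /k ltnS ?leq_maxl ?leq_maxr.
by rewrite vw.
Qed.

Definition sample (u : R) : config :=
  if pselect (0 <= u < 1) is left h
  then exist _ (sample_set u) (sample_set_independent h) else point.

Lemma val_sample u : 0 <= u < 1 -> val (sample u) = sample_set u.
Proof. by move=> u01; rewrite /sample; case: pselect. Qed.

Lemma unit_itvE : `[0%R, 1%R[%classic = [set u : R | 0 <= u < 1].
Proof. by rewrite set_itvE. Qed.

Lemma sample_word_ex u k : 0 <= u < 1 ->
  exists2 I, independent I & word_event site (sample_word u k) I.
Proof.
move=> u01; apply: contrapT => nE.
have := sample_wordP (sample_word u k) u01; rewrite size_sample_word eqxx.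
move=> /esym/andP[l1 l2]; have : 0 < word_prob (sample_word u k) by lra.
by rewrite /word_prob fadd0 ?ltxx // => I iI wI; apply: nE; exists I.
Qed.

(* [site] is not injective, but the bits of the sites listed twice agree. *)
Lemma sample_bit_site u i : 0 <= u < 1 ->
  sample_bit u (choice.pickle (site i)) = sample_bit u i.
Proof.
move=> u01; pose k := (maxn (choice.pickle (site i)) i).+1.
have [I _ /sample_word_event kI] := sample_word_ex k u01.
by rewrite -!kI ?pickle_site // /k ltnS ?leq_maxl ?leq_maxr.
Qed.

Lemma sample_word_mem k u : 0 <= u < 1 -> word_event site (sample_word u k) (sample_set u).
Proof.
move=> u01; elim: k => [//|k IH]; split=> //=; rewrite size_sample_word /sample_set /=.
by rewrite asboolb sample_bit_site.
Qed.

Lemma word_event_inj r r' I : size r = size r' ->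
  word_event site r I -> word_event site r' I -> r = r'.
Proof.
elim: r r' => [|b r IH] [|b' r'] //= [sr] [wI bI] [wI' bI'].
by rewrite -bI -bI' sr (IH r').
Qed.

Lemma sample_word_itv u r : 0 <= u < 1 -> word_event site r (sample_set u) <->
  word_left r <= u < word_left r + word_prob r.
Proof.
move=> u01; rewrite -sample_wordP //; split=> [wr|/eqP <-]; last exact: sample_word_mem.
apply/eqP; apply: word_event_inj wr; last exact: sample_word_mem.
by rewrite size_sample_word.
Qed.

Lemma word_left_bounds r : 0 <= word_left r /\ word_left r + word_prob r <= 1.
Proof.
elim: r => [|b r [IH1 IH2]]; first by rewrite /= add0r /word_prob /= (fadd_T pP).
have := word_probE r; have := word_prob_ge0 (true :: r); have := word_prob_ge0 (false :: r).
by case: b => /= h1 h2 h3; split; lra.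
Qed.

Lemma sample_preimage r : sample @^-1` config_event (word_event site r) `&` `[0%R, 1%R[ =
  `[word_left r, word_left r + word_prob r[%classic.
Proof.
rewrite unit_itvE set_itvE predeqE => u /=; have [w0 w1] := word_left_bounds r.
rewrite /config_event /=; split=> [[wu u01]|uw].
  by apply/sample_word_itv => //; rewrite -val_sample.
have u01 : 0 <= u < 1 
  by case/andP: uw => u0 u1; rewrite (le_trans w0 u0) (lt_le_trans u1 w1).
by split=> //; rewrite val_sample //; apply/sample_word_itv.
Qed.

Lemma measurable_unit_itv : measurable (`[0%R, 1%R[%classic : set R).
Proof. exact: measurable_itv. Qed.

Lemma measurable_sample : measurable_fun [set: R] (sample : R -> hc_space).
Proof.
apply: (@measurability _ _ R hc_space _ _ (occupied_in setT)) => //.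
move=> _ [_ [v _ <-] <-]; rewrite setTI.
(* The head of a word is its last bit, here the occupation of [v]. Outside [0, 1[ the sample is the
   empty configuration, which adds nothing to the preimage. *)
rewrite (_ : _ @^-1` _ = \bigcup_(r : seq bool)
  if (size r == (choice.pickle v).+1) && head false r
  then `[word_left r, word_left r + word_prob r[%classic else set0).
  apply: countable_bigcupT_measurable; first exact: countableP.
  by move=> r; case: ifP => _; [exact: measurable_itv|exact: measurable0].
rewrite predeqE => u /=; rewrite /occupied /=; split.
  rewrite /sample; case: pselect => // u01 /= uv.
  exists (sample_word u (choice.pickle v).+1) => //.
  rewrite size_sample_word eqxx (_ : head false _ = true); last exact: uv.
  have := sample_wordP (sample_word u (choice.pickle v).+1) u01.
  by rewrite size_sample_word eqxx andbT set_itvE => /esym.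
case=> r _; case: ifP => // /andP[/eqP sr hr]; rewrite -sample_preimage unit_itvE.
move=> [/= wr u01]; move: wr; rewrite /config_event /= val_sample //.
move=> /(sample_word_itv _ u01); rewrite -sample_wordP // sr => /eqP rE.
by rewrite /sample_set /= /sample_bit rE.
Qed.

Definition state_prob (A : set hc_space) : \bar R :=
  lebesgue_measure (sample @^-1` A `&` `[0%R, 1%R[).

Lemma measurable_sample_preimage (A : set hc_space) : measurable A ->
  measurable (sample @^-1` A `&` `[0%R, 1%R[).
Proof.
move=> mA; apply: measurableI; last exact: measurable_unit_itv.
by rewrite -[X in measurable X]setTI; exact: measurable_sample.
Qed.

Let state_prob0 : state_prob set0 = 0%E.
Proof. by rewrite /state_prob preimage_set0 set0I measure0. Qed.

Let state_prob_ge0 A : (0 <= state_prob A)%E.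
Proof. exact: measure_ge0. Qed.

Let state_prob_sigma_additive : semi_sigma_additive state_prob.
Proof.
move=> F mF tF mUF; rewrite /state_prob preimage_bigcup setI_bigcupl.
apply: measure_semi_sigma_additive.
- by move=> n; exact: measurable_sample_preimage.
- apply/trivIsetP => /= i j _ _ ij; rewrite setIACA -preimage_setI.
  by move/trivIsetP : tF => /(_ _ _ _ _ ij) ->//; rewrite preimage_set0 set0I.
- rewrite -setI_bigcupl -preimage_bigcup; exact: measurable_sample_preimage.
Qed.

HB.instance Definition _ := isMeasure.Build _ _ _ state_prob
  state_prob0 state_prob_ge0 state_prob_sigma_additive.

Let state_probT : state_prob setT = 1%E.
Proof.
rewrite /state_prob preimage_setT setTI lebesgue_measure_itv /= lte_fin ltr01.
by rewrite sube0.
Qed.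

HB.instance Definition _ := Measure_isProbability.Build _ _ _
  state_prob state_probT.

Lemma state_prob_word r : state_prob (config_event (word_event site r)) = (word_prob r)%:E.
Proof.
rewrite /state_prob sample_preimage lebesgue_measure_itv /= lte_fin ltrDl.
case: ltP => [_|w0]; first by rewrite -EFinB addrAC subrr add0r.
by rewrite (_ : word_prob r = 0) //; apply/le_anti; rewrite w0 word_prob_ge0.
Qed.

Lemma measurable_local_word k j r (E : set (set Z2)) : (size r + j)%N = k ->
  local [set site i | i in [set i | (i < k)%N]] E ->
  measurable (config_event (E `&` word_event site r) : set hc_space).
Proof.
move=> rk lE; have := local_word_measurable rk lE.
by apply: sub_sigma_algebra2; apply: image_subset.
Qed.

Lemma state_prob_local_word k j r (E : set (set Z2)) : (size r + j)%N = k ->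
  local [set site i | i in [set i | (i < k)%N]] E ->
  state_prob (config_event (E `&` word_event site r)) = (p (E `&` word_event site r))%:E.
Proof.
elim: j r => [|j IH] r; last first.
  rewrite addnS -addSn => rk lE; rewrite word_prob_split EFinD.
  rewrite -(IH (true :: r)) // -(IH (false :: r)) //.
  rewrite [X in config_event X]word_event_split.
  rewrite [X in state_prob X](_ : _ = config_event (E `&` word_event site (true :: r)) `|`
    config_event (E `&` word_event site (false :: r))) //.
  rewrite measureU //; last first.
  - by rewrite -subset0 => I [[_ [_ h1]] [_ [_ h2]]]; move: h2; rewrite /= h1.
  - exact: (@measurable_local_word k j (false :: r)).
  - exact: (@measurable_local_word k j (true :: r)).
rewrite addn0 => rk lE; have [|none|all] := @word_event_local site k r E _ lE.
- by rewrite rk.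
- rewrite fadd0 // (_ : config_event _ = set0) ?measure0 //.
  by rewrite -subset0 => I /= /none; apply; exact: config_ind.
- rewrite (_ : p _ = word_prob r); last first.
    by apply: fadd_eq => I iI; split=> [[]//|wI]; split=> //; exact: all.
  rewrite -state_prob_word; congr state_prob.
  rewrite predeqE => I; rewrite /config_event /=; split=> [[]//|wI]; split=> //.
  by apply: all => //; exact: config_ind.
Qed.

Lemma finitely_additive_extension : exists P : probability hc_space R,
  forall (D : {fset Z2}) E, local [set` D] E -> P (config_event E) = (p E)%:E.
Proof.
exists state_prob => D E lE.
pose k := (\max_(v <- enum_fset D) choice.pickle v).+1.
have lE' : local [set site i | i in [set i | (i < k)%N]] E.
  apply: local_sub lE => v /= vD; exists (choice.pickle v); last exact: pickle_site.
  by rewrite /= /k ltnS; apply: (@leq_bigmax_seq _ _ xpredT (fun v => choice.pickle v)).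
by have := @state_prob_local_word k k [::] E (add0n _) lE'; rewrite /= setIT.
Qed.

End Additive.

(** * Phase coexistence *)

Section DLR.
Context d (T : measurableType d) (R : realType) (P : probability T R).
Variables (G : set (set T)) (A : set T) (I : Type) (s : seq I).
Variables (c : I -> R) (V : I -> set T).
Hypotheses (setIG : setI_closed G) (GT : G setT) (mG : G `<=` measurable).
Hypotheses (mA : measurable A) (mV : forall i, measurable (V i)).
Hypothesis c_ge0 : forall i, 0 <= c i.

(** Both sides are finite measures in [B], so the sets on which they agree form a lambda-system, and
    [G] is a pi-system containing the whole space. *)
Lemma dlr_sigma_algebra :
  (forall B, G B -> P (A `&` B) = \sum_(i <- s) (c i)%:E * P (V i `&` B))%E ->
  forall B, <<s G >> B -> P (A `&` B) = (\sum_(i <- s) (c i)%:E * P (V i `&` B))%E.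
Proof.
move=> eqG.
suff : <<s G >> `<=` [set B | measurable B /\
    P (A `&` B) = (\sum_(i <- s) (c i)%:E * P (V i `&` B))%E].
  by move=> sub B /sub[].
apply: lambda_system_subset => //; last by move=> B GB; split; [exact: mG|exact: eqG].
apply/dynkin_lambda_system; split => [|B [mB eB]|F tF mF].
- by split; [exact: measurableT|exact: eqG].
- split; first exact: measurableC.
  have fineP X : measurable X -> P X = (fine (P X))%:E.
    by move=> mX; rewrite fineK // fin_num_measure.
  (* Complements require subtraction, which is carried out on the real values. *)
  have fineC X : measurable X -> fine (P (X `&` ~` B)) = fine (P X) - fine (P (X `&` B)).
    move=> mX; rewrite -setDE measureD //; last by rewrite -ge0_fin_numE ?fin_num_measure.
    by rewrite fineB ?fin_num_measure //; exact: measurableI.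
  have mXB X : measurable X -> measurable (X `&` B) by move=> ?; exact: measurableI.
  have mXC X : measurable X -> measurable (X `&` ~` B).
    by move=> ?; apply: measurableI => //; exact: measurableC.
  have sumE (h : I -> set T) : (forall i, measurable (h i)) ->
      (\sum_(i <- s) (c i)%:E * P (h i) = (\sum_(i <- s) c i * fine (P (h i)))%:E)%E.
    by move=> mh; rewrite -sumEFin; apply: eq_bigr => i _; rewrite (fineP (h i)).
  have realE X (h : I -> set T) : (forall i, measurable (h i)) ->
      P X = (\sum_(i <- s) (c i)%:E * P (h i))%E ->
      fine (P X) = \sum_(i <- s) c i * fine (P (h i)).
    by move=> mh ->; rewrite sumE.
  have eT : P A = (\sum_(i <- s) (c i)%:E * P (V i))%E.
    have := eqG _ GT; rewrite setIT => ->.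
    by apply: eq_bigr => i _; rewrite setIT.
  have rB := realE _ _ (fun i => mXB _ (mV i)) eB.
  have rT := realE _ _ mV eT.
  rewrite (fineP _ (mXC _ mA)) (sumE _ (fun i => mXC _ (mV i))); congr (_%:E).
  rewrite fineC // rB rT -sumrB.
  by apply: eq_bigr => i _; rewrite fineC // mulrBr.
- split; first by apply: bigcup_measurable => k _; have [] := mF k.
  have bigE X : measurable X ->
      P (X `&` \bigcup_k F k) = (\sum_(k <oo) P (X `&` F k))%E.
    move=> mX; rewrite setI_bigcupr measure_bigcup.
    + by apply: eq_eseriesl => k; rewrite in_setT.
    + by move=> k _; apply: measurableI => //; have [] := mF k.
    + exact: trivIset_setIl.
  rewrite bigE // (eq_eseriesr (fun k _ => (mF k).2)) nneseries_sum; last first.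
    by move=> i j _; rewrite mule_ge0 // lee_fin.
  by apply: eq_bigr => i _; rewrite nneseriesZl // bigE.
Qed.
End DLR.

Section Gibbs.
Variables (R : realType) (lambda : R).
Hypothesis lambda_gt0 : 0 < lambda.
Variable p : set (set Z2) -> R.
Variable P : probability hc_space R.
Hypothesis Pp : forall (D : {fset Z2}) E, local [set` D] E -> P (config_event E) = (p E)%:E.

Definition cylinders (S : set Z2) : set (set config) :=
  [set B | exists (D : {fset Z2}) E,
    [/\ [set` D] `<=` S, local [set` D] E & B = config_event E]].

Lemma occupied_cylinders S : <<s occupied_in S >> `<=` <<s cylinders S >>.
Proof.
apply: sub_sigma_algebra2 => _ [v Sv <-].
exists [fset v]%fset, [set I | I v]; split=> //.
  by move=> x /=; rewrite inE => /eqP ->.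
by move=> I I' _ _ II'; apply: (proj1 (II' v _)); rewrite /= inE.
Qed.

Lemma cylinders_setI S : setI_closed (cylinders S).
Proof.
move=> _ _ [D [E [DS lE ->]]] [D' [E' [DS' lE' ->]]].
exists (D `|` D')%fset, (E `&` E'); split=> //.
  by move=> x /=; rewrite in_fsetU => /orP[/DS|/DS'].
by apply: localI; [apply: local_sub lE|apply: local_sub lE'] => x /= xD;
  rewrite in_fsetU xD ?orbT.
Qed.

Lemma cylinders_measurable S :
  cylinders S `<=` (measurable : set (set hc_space)).
Proof.
move=> _ [D [E [_ lE ->]]]; have := local_measurable lE.
by apply: sub_sigma_algebra2; apply: image_subset.
Qed.

(** The specification is constant on each event [adm V], hence a finite combination of indicators.
    Its measurability and its integral over [B] reduce to finite unions and sums, and the required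
    identity is extended from cylinders. *)
Lemma gibbs_state_of_local :
  (forall (L J : {fset Z2}) E, (J `<=` L)%fset -> local (~` [set` L]) E ->
    p (inside L J `&` E) = \sum_(V <- fpowerset (fpowerset L))
      spec_value lambda J V * p ([set X | admissible L X = V] `&` E)) ->
  gibbs_state lambda P.
Proof.
move=> p_dlr L J JL.
have [D DL Dloc] := admissible_local L.
pose Vs := fpowerset (fpowerset L).
pose adm V : set config := config_event [set X | admissible L X = V].
have mV V : measurable (adm V : set hc_space).
  by apply: (@cylinders_measurable setT); exists D, [set X | admissible L X = V].
have specE : hc_spec lambda L J =
    fun I : config => spec_value lambda J (admissible L (val I)).
  by apply/funext => I; exact: hc_specE.
have admV (I : config) : admissible L (val I) \in Vs.
  by rewrite fpowersetE; apply/fsubsetP => K; rewrite mem_admissible fpowersetE => /andP[].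
split.
  move=> Y _.
  rewrite (_ : _ @^-1` Y = \big[setU/set0]_(V <- Vs)
      (if `[< Y (spec_value lambda J V) >] then adm V else set0)).
    apply: (big_ind (fun B => <<s occupied_in (~` [set` L]) >> B)).
    - exact: sigma_algebra0.
    - exact: sigma_algebra_setU.
    - move=> V _; case: ifP => _; last exact: sigma_algebra0.
      have := local_measurable (Dloc V); apply: sub_sigma_algebra2.
      exact: image_subset.
  rewrite -bigcup_seq specE predeqE => I; split=> [YI|[V _]].
    exists (admissible L (val I)); first exact: admV.
    by rewrite asboolT.
  by case: asboolP => // YV; rewrite /adm /config_event /= => ->.
move=> B sB.
have mB : measurable (B : set hc_space).
  by move: sB; apply: sub_sigma_algebra2; exact: image_subset.
have insE : inside_is L J = config_event (inside L J) by [].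
have mI : measurable (inside_is L J : set hc_space).
  by apply: (@cylinders_measurable setT); exists L, (inside L J); split=> //; exact: inside_local.
transitivity (\sum_(V <- Vs) (spec_value lambda J V)%:E * P (adm V `&` B))%E.
  apply: (@dlr_sigma_algebra _ hc_space R P (cylinders (~` [set` L]))) => //.
  - exact: cylinders_setI.
  - by exists fset0, setT; split.
  - exact: cylinders_measurable.
  - by move=> V; exact: spec_value_ge0.
  - move=> _ [D' [E [DL' lE ->]]].
    have lE' : local (~` [set` L]) E by exact: local_sub lE.
    rewrite insE -[_ `&` _]/(config_event (inside L J `&` E)).
    rewrite (Pp (D := (L `|` D')%fset)); last first.
      apply: localI; [apply: local_sub (@inside_local L J)|apply: local_sub lE];
        by move=> x /= xD; rewrite in_fsetU xD ?orbT.
    rewrite p_dlr // -sumEFin; apply: eq_bigr => V _; rewrite EFinM; congr (_ * _)%E.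
    rewrite (_ : adm V `&` _ = config_event ([set X | admissible L X = V] `&` E)) //.
    rewrite (Pp (D := (D `|` D')%fset)) //.
    apply: localI; [apply: local_sub (Dloc V)|apply: local_sub lE];
      by move=> x /= xD; rewrite in_fsetU xD ?orbT.
  - exact: occupied_cylinders.
transitivity (\int[P]_(x in B) \sum_(V <- Vs)
    ((spec_value lambda J V)%:E * (\1_(adm V) x)%:E))%E.
  rewrite ge0_integral_sum //.
  - apply: eq_bigr => V _; rewrite ge0_integralZl_EFin //.
    + by rewrite integral_indic.
    + by apply/measurable_EFinP; exact: measurable_indic.
    + exact: spec_value_ge0.
  - move=> V; apply/measurable_EFinP/measurable_funM => //; exact: measurable_indic.
  - by move=> V x _; rewrite -EFinM lee_fin mulr_ge0 // spec_value_ge0.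
apply: eq_integral => I _; rewrite specE.
rewrite (bigD1_seq (admissible L (val I))) ?fset_uniq //=; last exact: admV.
rewrite big1 ?adde0 => [|V VI].
  by rewrite indicE mem_set // mule1.
by rewrite indicE memNset ?mule0 // => /= VE; rewrite -VE eqxx in VI.
Qed.
End Gibbs.

Theorem theorem3p1 (R : realType) (lambda : R)
    (hlambda : taxi_connective_constant R ^+ 4 - 1 < lambda) :
  multiple_gibbs_states lambda.
Proof.
have lambda_gt0 : 0 < lambda.
  have [L1 _] := taxi_connective_constantP R.
  by have := exprn_ege1 4 L1; lra.
have [k [m bound]] := box_prob_escape lambda_gt0 hlambda.
have [p padd [pdlr ple]] := limit_state true lambda_gt0.
have [p' padd' [pdlr' ple']] := limit_state false lambda_gt0.
have [P Pp] := finitely_additive_extension padd.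
have [P' Pp'] := finitely_additive_extension padd'.
exists P, P'; split; [exact: gibbs_state_of_local pdlr|exact: gibbs_state_of_local pdlr'|].
have lE := @escape_local true k m.
exists (config_event (escape true k m)).
  by apply: (@cylinders_measurable setT); exists (box m.+2), (escape true k m).
rewrite (Pp _ _ lE) (Pp' _ _ lE) => -[pp'].
(* The same event [escape true k m] has probability at most 1/3 in the state with boundary parity
   [false] and at least 2/3 in the one with boundary parity [true]. *)
have := ple' (escape true k m) m (1 / 3) (fun n mn => (bound false n mn).1).
have := ple (~` escape true k m) m (1 / 3) (fun n mn => (bound true n mn).2).
have := fadd_split padd setT (escape true k m).
rewrite !setTI (fadd_T padd); lra.
Qed.
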